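(* Let $R$ be a semilocal commutative ring. Then the following conditions are equivalent: (1) $R$ is $2$-semiregular; (2) every finitely presented cyclic $R$-module is $2$-periodic; (3) $R$ is semiregular and arithmetical.
   Context: All rings are commutative with identity and all modules are unitary. Semilocal means having finitely many maximal ideals (no Noetherian hypothesis). An $R$-module $M$ is $2$-periodic if there is an exact sequence $0\to M\to P_2\to P_1\to M\to 0$ with $P_1,P_2$ projective; $R$ is $2$-semiregular if every finitely presented $R$-module is $2$-periodic. $R$ is semiregular if every $R$-module embeds into a flat $R$-module. $R$ is a valuation ring if its ideals are totally ordered by inclusion (zero divisors are allowed); $R$ is arithmetical if $R_P$ is a valuation ring for each maximal ideal $P$. *)

(* Defs.v *)
From HB Require Import structures.
From mathcomp Require Import all_boot all_algebra generic_quotient ring.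
From mathcomp Require Import boolp classical_sets cardinality.

Set Implicit Arguments.
Unset Strict Implicit.
Unset Printing Implicit Defensive.

Import GRing.Theory.
Local Open Scope ring_scope.
Local Open Scope classical_set_scope.
Local Open Scope quotient_scope.

(* Rings are [comPzRingType]s, so the zero ring is allowed. *)

Section Ideals.
Variable R : comPzRingType.

Definition is_ideal (I : set R) : Prop :=
  [/\ I 0, forall x y, I x -> I y -> I (x + y) & forall a x, I x -> I (a * x)].

Definition maximal_ideal (P : set R) : Prop :=
  [/\ is_ideal P, ~ P 1 &
      forall I : set R, is_ideal I -> ~ I 1 -> P `<=` I -> I = P].

Definition semilocal : Prop := finite_set [set P : set R | maximal_ideal P].

Definition valuation_ring : Prop :=
  forall I J : set R, is_ideal I -> is_ideal J -> I `<=` J \/ J `<=` I.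

End Ideals.

(* The localization of [R] at a multiplicatively closed subset [S]: fractions
   [(a, s)] with [s \in S], where [(a, s) ~ (b, t)] when [u * (a * t) =
   u * (b * s)] for some [u \in S]. *)
Module Localization.
Section Localization.
Variables (R : comPzRingType) (S : mulrClosed R).

Local Notation den := {s : R | s \in S}.

Definition den1 : den := exist _ 1 (rpred1 S).
Lemma denM_subproof (s t : den) : val s * val t \in S.
Proof. by apply: rpredM; exact: valP. Qed.
Definition denM (s t : den) : den :=
  exist _ (val s * val t) (denM_subproof s t).

Local Notation fraction := (R * den)%type.

Implicit Types x y z : fraction.

Definition equiv_prop x y : Prop :=
  exists u : den, val u * (x.1 * val y.2) = val u * (y.1 * val x.2).
Definition equiv : rel fraction := fun x y => `[< equiv_prop x y >].

Lemma equiv_is_equiv : equiv_class_of equiv.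
Proof.
split=> [x|x y|y x z].
- by apply/asboolP; exists den1.
- by apply/asboolP/asboolP => -[u e]; exists u.
- move=> /asboolP[u e] /asboolP[v f]; apply/asboolP.
  exists (denM (denM u v) y.2) => /=.
  have -> : val u * val v * val y.2 * (x.1 * val z.2) =
     val v * val z.2 * (val u * (x.1 * val y.2)) by ring.
  have -> : val u * val v * val y.2 * (z.1 * val x.2) =
     val u * val x.2 * (val v * (z.1 * val y.2)) by ring.
  by rewrite e -f; ring.
Qed.

Canonical equiv_equiv := EquivRelPack equiv_is_equiv.
Canonical equiv_encModRel := defaultEncModRel equiv.

Definition type := {eq_quot equiv}.
HB.instance Definition _ : EqQuotient fraction equiv type :=
  EqQuotient.on type.
HB.instance Definition _ := Choice.on type.

Lemma eq_piP x y : reflect (equiv_prop x y) (x == y %[mod type]).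
Proof. by rewrite eqmodE; exact: asboolP. Qed.

Lemma repr_piP x : equiv_prop (repr (\pi_type x)) x.
Proof. by apply/eq_piP; rewrite reprK. Qed.

Definition addf x y : fraction :=
  (x.1 * val y.2 + y.1 * val x.2, denM x.2 y.2).
Definition add := lift_op2 type addf.

Lemma pi_add : {morph \pi : x y / addf x y >-> add x y}.
Proof.
move=> x y; unlock add; apply/eqP/eq_piP.
have [u] := repr_piP x; have [v] := repr_piP y.
move: (repr (\pi x)) (repr (\pi y)) => x' y' /= f e.
exists (denM u v) => /=.
have -> : sval u * sval v * ((x.1 * sval y.2 + y.1 * sval x.2)
    * (sval x'.2 * sval y'.2)) =
    sval u * (x.1 * sval x'.2) * (sval v * sval y.2 * sval y'.2) +
    sval v * (y.1 * sval y'.2) * (sval u * sval x.2 * sval x'.2) by ring.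
by rewrite -e -f; ring.
Qed.
Canonical pi_add_morph := PiMorph2 pi_add.

Definition oppf x : fraction := (- x.1, x.2).
Definition opp := lift_op1 type oppf.

Lemma pi_opp : {morph \pi : x / oppf x >-> opp x}.
Proof.
move=> x; unlock opp; apply/eqP/eq_piP.
have [u e] := repr_piP x; exists u => /=.
by rewrite !mulNr !mulrN e.
Qed.
Canonical pi_opp_morph := PiMorph1 pi_opp.

Definition mulf x y : fraction := (x.1 * y.1, denM x.2 y.2).
Definition mul := lift_op2 type mulf.

Lemma pi_mul : {morph \pi : x y / mulf x y >-> mul x y}.
Proof.
move=> x y; unlock mul; apply/eqP/eq_piP.
have [u] := repr_piP x; have [v] := repr_piP y.
move: (repr (\pi x)) (repr (\pi y)) => x' y' /= f e.
exists (denM u v) => /=.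
have -> : sval u * sval v * (x.1 * y.1 * (sval x'.2 * sval y'.2)) =
    sval u * (x.1 * sval x'.2) * (sval v * (y.1 * sval y'.2)) by ring.
by rewrite -e -f; ring.
Qed.
Canonical pi_mul_morph := PiMorph2 pi_mul.

Definition zero := lift_cst type (0, den1).
Canonical pi_zero_morph := PiConst zero.
Definition one := lift_cst type (1, den1).
Canonical pi_one_morph := PiConst one.

Lemma addA : associative add.
Proof.
elim/quotW=> x; elim/quotW=> y; elim/quotW=> z; rewrite !piE.
by apply/eqP/eq_piP; exists den1 => /=; ring.
Qed.

Lemma addC : commutative add.
Proof.
elim/quotW=> x; elim/quotW=> y; rewrite !piE.
by apply/eqP/eq_piP; exists den1 => /=; ring.
Qed.

Lemma add0 : left_id zero add.
Proof.
elim/quotW=> x; rewrite !piE.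
by apply/eqP/eq_piP; exists den1 => /=; ring.
Qed.

Lemma addN : left_inverse zero opp add.
Proof.
elim/quotW=> x; rewrite !piE.
by apply/eqP/eq_piP; exists den1 => /=; ring.
Qed.

HB.instance Definition _ := GRing.isZmodule.Build type addA addC add0 addN.

Lemma mulA : associative mul.
Proof.
elim/quotW=> x; elim/quotW=> y; elim/quotW=> z; rewrite !piE.
by apply/eqP/eq_piP; exists den1 => /=; ring.
Qed.

Lemma mulC : commutative mul.
Proof.
elim/quotW=> x; elim/quotW=> y; rewrite !piE.
by apply/eqP/eq_piP; exists den1 => /=; ring.
Qed.

Lemma mul1 : left_id one mul.
Proof.
elim/quotW=> x; rewrite !piE.
by apply/eqP/eq_piP; exists den1 => /=; ring.
Qed.

Lemma mulDl : left_distributive mul add.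
Proof.
elim/quotW=> x; elim/quotW=> y; elim/quotW=> z; rewrite !piE.
by apply/eqP/eq_piP; exists den1 => /=; ring.
Qed.

HB.instance Definition _ :=
  GRing.Zmodule_isComPzRing.Build type mulA mulC mul1 mulDl.

End Localization.
End Localization.
HB.export Localization.

Notation localization := Localization.type.

Section MaximalComplement.
Variables (R : comPzRingType) (P : set R).
Hypothesis maxP : maximal_ideal P.

Definition max_compl of maximal_ideal P : {pred R} := [pred x | x \notin P].

Lemma max_complP x : reflect (~ P x) (x \in max_compl maxP).
Proof. by apply: (iffP negP); rewrite in_setE. Qed.

Lemma max_compl_closed : mulr_closed (max_compl maxP).
Proof.
have [[P0 PD PM] P1 Pmax] := maxP.
split=> [|x y /max_complP nPx /max_complP nPy]; first exact/max_complP.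
apply/max_complP => Pxy; pose I := [set z | P (z * y)].
have idI : is_ideal I.
  rewrite /I; split=> [|a b|a b] /=; first by rewrite mul0r.
    by rewrite mulrDl; exact: PD.
  by rewrite -mulrA; exact: PM.
apply: nPx; rewrite -(Pmax I idI) //; first by rewrite /I /= mul1r.
by move=> z Pz; rewrite /I /= mulrC; exact: PM.
Qed.

HB.instance Definition _ :=
  GRing.isMulClosed.Build R (max_compl maxP) max_compl_closed.

Definition localization_at : comPzRingType := localization (max_compl maxP).

End MaximalComplement.

Definition arithmetical (R : comPzRingType) : Prop :=
  forall (P : set R) (maxP : maximal_ideal P),
    valuation_ring (localization_at maxP).

(* The tensor product of [A] and [M] over [R]: the formal sums
   [a_1 # m_1 + ... + a_n # m_n], encoded as lists of pairs, modulo the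
   congruence generated by commutativity of the sum and by bilinearity of [#].
   Negatives come for free, being given by [- a # m]. *)
Section Tensor.
Variable R : comPzRingType.

Inductive tensor_eq (A M : lmodType R) : seq (A * M) -> seq (A * M) -> Prop :=
| tensor_refl s : tensor_eq s s
| tensor_sym s t : tensor_eq s t -> tensor_eq t s
| tensor_trans s t u : tensor_eq s t -> tensor_eq t u -> tensor_eq s u
| tensor_cat s s' t t' :
    tensor_eq s s' -> tensor_eq t t' -> tensor_eq (s ++ t) (s' ++ t')
| tensor_catC s t : tensor_eq (s ++ t) (t ++ s)
| tensor_0l m : tensor_eq [:: (0, m)] [::]
| tensor_0r a : tensor_eq [:: (a, 0)] [::]
| tensor_Dl a b m : tensor_eq [:: (a + b, m)] [:: (a, m); (b, m)]
| tensor_Dr a m n : tensor_eq [:: (a, m + n)] [:: (a, m); (a, n)]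
| tensor_Z r a m : tensor_eq [:: (r *: a, m)] [:: (a, r *: m)].

Section Quotient.
Variables A M : lmodType R.

Definition tensor_rel : rel (seq (A * M)) := fun s t => `[< tensor_eq s t >].

Lemma tensor_rel_is_equiv : equiv_class_of tensor_rel.
Proof.
split=> [s|s t|t s u].
- exact/asboolP/tensor_refl.
- by apply/asboolP/asboolP => /tensor_sym.
- move=> /asboolP st /asboolP tu; exact/asboolP/(tensor_trans st tu).
Qed.

Canonical tensor_rel_equiv := EquivRelPack tensor_rel_is_equiv.
Canonical tensor_rel_encModRel := defaultEncModRel tensor_rel.

Definition tensor := {eq_quot tensor_rel}.
HB.instance Definition _ : EqQuotient (seq (A * M)) tensor_rel tensor :=
  EqQuotient.on tensor.
HB.instance Definition _ := Choice.on tensor.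

Lemma eq_tensorP (s t : seq (A * M)) :
  reflect (tensor_eq s t) (s == t %[mod tensor]).
Proof. by rewrite eqmodE; exact: asboolP. Qed.

End Quotient.

Section Map.
Variables (A B M : lmodType R) (f : {linear A -> B}).

Definition tensor_map_seq (s : seq (A * M)) : seq (B * M) :=
  [seq (f p.1, p.2) | p <- s].

Definition tensor_map (t : tensor A M) : tensor B M :=
  \pi_(tensor B M) (tensor_map_seq (repr t)).

Lemma tensor_map_pi (s : seq (A * M)) :
  tensor_map (\pi_(tensor A M) s) = \pi_(tensor B M) (tensor_map_seq s).
Proof.
have map_eq s1 s2 : tensor_eq s1 s2 ->
    tensor_eq (tensor_map_seq s1) (tensor_map_seq s2).
  rewrite /tensor_map_seq; elim=> {s1 s2} //=.
  - by move=> *; exact: tensor_refl.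
  - by move=> ? ? _; exact: tensor_sym.
  - by move=> ? ? ? _ h1 _ h2; exact: tensor_trans h1 h2.
  - by move=> ? ? ? ? _ h1 _ h2; rewrite !map_cat; exact: tensor_cat.
  - by move=> ? ?; rewrite !map_cat; exact: tensor_catC.
  - by move=> m; rewrite raddf0; exact: tensor_0l.
  - by move=> a; exact: tensor_0r.
  - by move=> a b m; rewrite raddfD; exact: tensor_Dl.
  - by move=> a m n; exact: tensor_Dr.
  - by move=> r a m; rewrite linearZ; exact: tensor_Z.
by apply/eqP/eq_tensorP/map_eq/eq_tensorP; rewrite reprK.
Qed.

End Map.
End Tensor.

Section Modules.
Variable R : comPzRingType.

Definition flat (M : lmodType R) : Prop :=
  forall (A B : lmodType R) (f : {linear A -> B}),
    injective f -> injective (@tensor_map R A B M f).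

Definition surjective (A B : Type) (f : A -> B) : Prop :=
  forall y, exists x, f x = y.

Definition exact_at (A B C : lmodType R) (f : A -> B) (g : B -> C) : Prop :=
  forall y, g y = 0 <-> exists x, f x = y.

Definition projective (P : lmodType R) : Prop :=
  forall (A B : lmodType R) (g : {linear A -> B}) (f : {linear P -> B}),
    surjective g -> exists h : {linear P -> A}, forall x, g (h x) = f x.

Definition finitely_presented (M : lmodType R) : Prop :=
  exists (m n : nat) (g : {linear 'rV[R]_m -> 'rV[R]_n})
         (f : {linear 'rV[R]_n -> M}), exact_at g f /\ surjective f.

Definition cyclic_module (M : lmodType R) : Prop :=
  exists x : M, forall y : M, exists r : R, y = r *: x.

Definition two_periodic (M : lmodType R) : Prop :=
  exists (P2 P1 : lmodType R) (i : {linear M -> P2}) (d : {linear P2 -> P1})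
         (e : {linear P1 -> M}),
    [/\ projective P1 /\ projective P2, injective i, exact_at i d,
        exact_at d e & surjective e].

End Modules.

Definition two_semiregular (R : comPzRingType) : Prop :=
  forall M : lmodType R, finitely_presented M -> two_periodic M.

Definition semiregular (R : comPzRingType) : Prop :=
  forall M : lmodType R,
    exists (F : lmodType R) (i : {linear M -> F}), flat F /\ injective i.

(* Main.v *)
Require Import Defs.
From HB Require Import structures.
From mathcomp Require Import all_boot all_algebra generic_quotient ring.
From mathcomp Require Import boolp classical_sets functions cardinality.

Set Implicit Arguments.
Unset Strict Implicit.
Unset Printing Implicit Defensive.

Import GRing.Theory.
Local Open Scope ring_scope.
Local Open Scope classical_set_scope.
Local Open Scope quotient_scope.

(** The conditions are linked by one property of matrices. Call a matrix A
    over R periodic when its image is also the image of a square matrix A',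
    and there is B with ker B = im A' and ker A' = im B, while ker A is
    finitely generated as well. Then 0 -> coker A -> R^n -> R^n -> coker A
    -> 0 is exact, the first map being B and the second A'; so if every
    matrix is periodic, every finitely presented module is 2-periodic
    ([periodic_mx_two_semiregular]). The theorem follows from the following
    three facts.

    First, let R be semilocal, with the ideals of each localization at a
    maximal ideal totally ordered. At each maximal ideal some entry of a
    given matrix divides all the others; as there are finitely many maximal
    ideals, elements can be chosen in some of them and outside the others,
    so that elementary operations produce an entry that divides the whole
    matrix at all of them at once, hence globally ([ex_pivot]). Clearing its
    row and its column, one diagonalizes, and periodicity of all matrices
    reduces to that of elements d: find c with ann c = R d and ann d = R c.
    By the same pivots the finitely generated ideals are principal, so it is
    enough that every R d be the annihilator of a finite set
    ([ex_periodic_elements]).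

    Secondly, that last condition follows from semiregularity: if R/d embeds
    in a flat module, the image x of 1 is killed by d, hence is a
    combination of elements of that module with coefficients in ann d
    ([flat_torsion]), and these coefficients have annihilator R d. It also follows from
    the 2-periodicity of cyclic modules. Write R/I, with I = (a, b), in an
    exact sequence 0 -> R/I -> P2 -> P1 -> R/I -> 0. Comparing with R ->
    R/I, one may replace P1 by R: this gives 0 -> R/I -> Q -> I -> 0 with Q
    projective and generated by three elements. The coordinates of the image
    of 1 in Q have annihilator I, and an elementary study of the syzygies of
    (a, b) shows that I is locally principal, a or b being a generator
    ([periodic_locally_comparable]).

    Thirdly, if all matrices are periodic then every module M embeds in a
    flat one ([flat_embedding]). All finitely presented modules embed in
    free ones, and compactness passes from these to M: the flat module is a
    reduced power of R indexed by all functions M -> R, where two families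
    are identified when they agree at all the functions that respect some
    finite set of linear relations of M. It is flat because kernels of
    matrices are finitely generated. *)

(** * Linear maps, submodules and quotients *)

Lemma linear_of (R : comPzRingType) (U V : lmodType R) (f : U -> V) :
  linear f -> exists g : {linear U -> V}, g =1 f.
Proof.
move=> lf; pose L := GRing.isLinear.Build R U V *:%R f lf.
by pose g : {linear U -> V} := HB.pack f L; exists g.
Qed.

Lemma factor_linear (R : comPzRingType) (U V W : lmodType R)
    (f : {linear U -> V}) (h : {linear U -> W}) :
  surjective f -> (forall u, f u = 0 -> h u = 0) ->
  exists i : {linear V -> W}, forall u, i (f u) = h u.
Proof.
move=> /choice[g gK] hf.
have hE u u' : f u = f u' -> h u = h u'.
  by move=> /eqP; rewrite -subr_eq0 -raddfB => /eqP/hf/eqP;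
     rewrite raddfB subr_eq0 => /eqP.
have [i iE] : exists i : {linear V -> W}, i =1 h \o g.
  by apply: linear_of => a x y /=; rewrite -linearP; apply: hE;
     rewrite linearP !gK.
by exists i => u; rewrite iE /=; apply: hE; rewrite gK.
Qed.

Definition is_submodule (R : comPzRingType) (V : lmodType R) (N : set V) :=
  [/\ N 0, forall x y, N x -> N y -> N (x + y) & forall a x, N x -> N (a *: x)].

Module QuotientModule.
Section QuotientModule.
Variables (R : comPzRingType) (V : lmodType R) (N : set V).
Hypothesis subN : is_submodule N.

Definition equiv of is_submodule N : rel V := fun x y => `[< N (x - y) >].

Lemma equiv_is_equiv : equiv_class_of (equiv subN).
Proof.
have [N0 ND NZ] := subN.
split=> [x|x y|y x z]; first by apply/asboolP; rewrite subrr.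
  by apply/asboolP/asboolP => /(NZ (-1)); rewrite scaleN1r opprB.
by move=> /asboolP xy /asboolP yz; apply/asboolP; have := ND _ _ xy yz;
   rewrite addrA subrK.
Qed.

Canonical equiv_equiv := EquivRelPack equiv_is_equiv.
Canonical equiv_encModRel := defaultEncModRel (equiv subN).

Definition type := {eq_quot (equiv subN)}.
HB.instance Definition _ : EqQuotient V (equiv subN) type :=
  EqQuotient.on type.
HB.instance Definition _ := Choice.on type.

Lemma eq_piP x y : reflect (N (x - y)) (x == y %[mod type]).
Proof. by rewrite eqmodE; exact: asboolP. Qed.

Lemma repr_piP x : N (repr (\pi_type x) - x).
Proof. by apply/eq_piP; rewrite reprK. Qed.

Definition add := lift_op2 type (fun x y : V => x + y).
Lemma pi_add : {morph \pi : x y / x + y >-> add x y}.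
Proof.
move=> x y; unlock add; apply/eqP; rewrite eq_sym; apply/eq_piP.
by rewrite opprD addrACA; have [_ ND _] := subN; apply: ND; exact: repr_piP.
Qed.
Canonical pi_add_morph := PiMorph2 pi_add.

Definition opp := lift_op1 type (fun x : V => - x).
Lemma pi_opp : {morph \pi : x / - x >-> opp x}.
Proof.
move=> x; unlock opp; apply/eqP; rewrite eq_sym; apply/eq_piP.
by rewrite -opprD -[X in N X]scaleN1r; have [_ _ NZ] := subN;
   apply: NZ; exact: repr_piP.
Qed.
Canonical pi_opp_morph := PiMorph1 pi_opp.

Definition scale (a : R) := lift_op1 type (fun x : V => a *: x).
Lemma pi_scale a : {morph \pi : x / a *: x >-> scale a x}.
Proof.
move=> x; unlock scale; apply/eqP; rewrite eq_sym; apply/eq_piP.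
by rewrite -scalerBr; have [_ _ NZ] := subN; apply: NZ; exact: repr_piP.
Qed.
Canonical pi_scale_morph a := PiMorph1 (pi_scale a).

Definition zero := lift_cst type (0 : V).
Canonical pi_zero_morph := PiConst zero.

Lemma addA : associative add.
Proof.
by elim/quotW=> x; elim/quotW=> y; elim/quotW=> z; rewrite !piE addrA.
Qed.
Lemma addC : commutative add.
Proof. by elim/quotW=> x; elim/quotW=> y; rewrite !piE addrC. Qed.
Lemma add0 : left_id zero add.
Proof. by elim/quotW=> x; rewrite !piE add0r. Qed.
Lemma addN : left_inverse zero opp add.
Proof. by elim/quotW=> x; rewrite !piE addNr. Qed.
HB.instance Definition _ := GRing.isZmodule.Build type addA addC add0 addN.

Lemma scaleA a b x : scale a (scale b x) = scale (a * b) x.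
Proof. by elim/quotW: x => x; rewrite !piE scalerA. Qed.
Lemma scale1 : left_id 1 scale.
Proof. by elim/quotW=> x; rewrite !piE scale1r. Qed.
Lemma scaleDr : right_distributive scale +%R.
Proof.
move=> a; elim/quotW=> x; elim/quotW=> y.
by rewrite -[_ + _]/(add _ _) -[RHS]/(add _ _) !piE scalerDr.
Qed.
Lemma scaleDl x : {morph scale^~ x : a b / a + b}.
Proof.
by move=> a b; elim/quotW: x => x; rewrite -[RHS]/(add _ _) !piE scalerDl.
Qed.
HB.instance Definition _ :=
  GRing.Zmodule_isLmodule.Build R type scaleA scale1 scaleDr scaleDl.

Lemma pi_linear : linear (\pi_type : V -> type).
Proof.
move=> a x y; rewrite -[RHS]/(add (scale a _) _).
by rewrite pi_add pi_scale.
Qed.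

End QuotientModule.
End QuotientModule.
HB.export QuotientModule.

Lemma ex_quotient (R : comPzRingType) (V : lmodType R) (N : set V) :
  is_submodule N ->
  exists (Q : lmodType R) (p : {linear V -> Q}),
    surjective p /\ forall x, p x = 0 <-> N x.
Proof.
move=> subN; have [p pE] := @linear_of R V (QuotientModule.type subN)
  _ (QuotientModule.pi_linear subN).
exists (QuotientModule.type subN), p; split=> [y|x].
  by exists (repr y); rewrite pE reprK.
have p0 : p 0 = 0 by exact: raddf0.
rewrite -p0 !pE; split=> [/eqP/QuotientModule.eq_piP|Nx].
  by rewrite subr0.
by apply/eqP/QuotientModule.eq_piP; rewrite subr0.
Qed.

(** * Maximal ideals and divisibility after localization *)

Section LocalDivisibility.
Variable R : comPzRingType.
Implicit Types (P I K : set R) (a b d x y : R).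

Lemma ideal0 I : is_ideal I -> I 0. Proof. by case. Qed.
Lemma idealD I x y : is_ideal I -> I x -> I y -> I (x + y).
Proof. by case=> _ + _; apply. Qed.
Lemma idealMl I a x : is_ideal I -> I x -> I (a * x).
Proof. by case=> _ _; apply. Qed.
Lemma idealMr I a x : is_ideal I -> I x -> I (x * a).
Proof. by rewrite mulrC; exact: idealMl. Qed.
Lemma idealB I x y : is_ideal I -> I x -> I y -> I (x - y).
Proof.
by move=> idI Ix Iy; rewrite -mulN1r; apply: idealD => //; exact: idealMl.
Qed.
Lemma idealDr I x y : is_ideal I -> I x -> I (x + y) -> I y.
Proof.
by move=> idI Ix Ixy; have := idealB idI Ixy Ix; rewrite addrC addKr.
Qed.

Lemma maximal_is_ideal P : maximal_ideal P -> is_ideal P. Proof. by case. Qed.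
Lemma maximal1 P : maximal_ideal P -> ~ P 1. Proof. by case. Qed.
#[local] Hint Resolve maximal_is_ideal maximal1 : core.

Lemma maximalM P x y : maximal_ideal P -> ~ P x -> ~ P y -> ~ P (x * y).
Proof.
move=> maxP Px Py; have [_ PM] := max_compl_closed maxP.
by apply/(max_complP maxP)/PM; apply/max_complP.
Qed.

(** Krull's theorem. The empty set is admitted among the candidates for
    maximality because the form of Zorn's lemma used here asks for the union
    of every chain, the empty one included. *)
Lemma ex_maximal I : is_ideal I -> ~ I 1 ->
  exists2 P, maximal_ideal P & I `<=` P.
Proof.
move=> idI I1.
pose T J := J = set0 \/ [/\ is_ideal J, ~ J 1 & I `<=` J].
have [F FT totF|P [TP maxP]] := @Zorn_bigcup R T.
  have [F0|] := pselect (forall J, F J -> J = set0).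
    by left; apply/seteqP; split=> // x [J /F0 ->].
  move=> /existsNP[J0 /not_implyP[FJ0 J00]]; right.
  have TJ J x : F J -> J x -> [/\ is_ideal J, ~ J 1 & I `<=` J].
    by move=> /FT[-> //|].
  have [idJ0 _ IJ0] : [/\ is_ideal J0, ~ J0 1 & I `<=` J0].
    by case: (FT _ FJ0).
  split; last by move=> x Ix; exists J0 => //; exact: IJ0.
    split; first by exists J0 => //; exact: ideal0.
      move=> x y [J FJ Jx] [J' FJ' J'y].
      have [idJ _ _] := TJ _ _ FJ Jx; have [idJ' _ _] := TJ _ _ FJ' J'y.
      have [JJ'|J'J] := totF _ _ FJ FJ'.
        by exists J' => //; apply: idealD => //; exact: JJ'.
      by exists J => //; apply: idealD => //; exact: J'J.
    move=> a x [J FJ Jx]; exists J => //; apply: idealMl => //.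
    by have [] := TJ _ _ FJ Jx.
  by move=> [J FJ J1]; have [] := TJ _ _ FJ J1.
have [idP P1 IP] : [/\ is_ideal P, ~ P 1 & I `<=` P].
  case: TP => // P0; exfalso; apply: (maxP I); last by right; split=> // x.
  by rewrite P0; split=> // I0; case: (I0 0 (ideal0 idI)).
exists P => //; split=> // J idJ J1 PJ; apply: contrapT => JP.
apply: (maxP J); last by right; split=> //; apply: subset_trans PJ.
by split=> // JleP; apply: JP; apply/seteqP; split.
Qed.

(** The elements s with s x in I form an ideal, which by assumption lies in
    no maximal ideal. *)
Lemma mem_locally I x : is_ideal I ->
  (forall P, maximal_ideal P -> exists2 s, ~ P s & I (s * x)) -> I x.
Proof.
move=> idI locI; pose J := [set s | I (s * x)].
have idJ : is_ideal J.
  split=> [|a b|a b]; rewrite /J /= ?mul0r; first exact: ideal0.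
    by rewrite mulrDl; exact: idealD.
  by rewrite -mulrA; exact: idealMl.
apply: contrapT => Ix; have [|P maxP JP] := ex_maximal idJ.
  by rewrite /J /= mul1r.
by have [s Ps /JP] := locI P maxP.
Qed.

(** Divisibility of a by d in the localization at P, with the denominators
    cleared. *)
Definition ldiv P d a := exists2 s, ~ P s & exists t, s * a = t * d.

Lemma ldiv_trans P d a b : maximal_ideal P ->
  ldiv P d a -> ldiv P a b -> ldiv P d b.
Proof.
move=> maxP [s Ps [t e]] [s' Ps' [t' e']]; exists (s * s').
  exact: maximalM.
by exists (t' * t); rewrite -mulrA e' mulrCA e mulrA.
Qed.

Lemma ldiv_ideal P d : maximal_ideal P -> is_ideal [set a | ldiv P d a].
Proof.
move=> maxP; split=> [|a b [s Ps [t e]] [s' Ps' [t' e']]|c a [s Ps [t e]]] /=.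
- by exists 1; [exact: maximal1|exists 0; rewrite mulr0 mul0r].
- exists (s * s'); first exact: maximalM.
  by exists (s' * t + s * t'); rewrite mulrDr mulrDl -[_ * t * d]mulrA
     -[s * t' * d]mulrA -e -e'; ring.
- by exists s => //; exists (c * t); rewrite mulrCA e mulrA.
Qed.

Definition locally_comparable :=
  forall P a b, maximal_ideal P -> ldiv P a b \/ ldiv P b a.

Lemma dvd_locally d a :
  (forall P, maximal_ideal P -> ldiv P d a) -> exists t, a = t * d.
Proof.
move=> loc; apply: (@mem_locally [set a | exists t, a = t * d]).
  split=> [|_ _ [t ->] [u ->]|c _ [t ->]]; first by exists 0; rewrite mul0r.
    by exists (t + u); rewrite mulrDl.
  by exists (c * t); rewrite mulrA.
by move=> P /loc[s]; exists s.
Qed.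

Section Semilocal.
Hypothesis semiR : semilocal R.
Hypothesis cmpR : locally_comparable.

Lemma maximal_seq :
  exists2 s : seq (set R), uniq s & forall P, maximal_ideal P <-> P \in s.
Proof.
have /finite_seqP[s sE] := semiR; exists (undup s); first exact: undup_uniq.
move=> P; rewrite mem_undup.
by have : [set P | maximal_ideal P] P <-> [set` s] P by rewrite sE.
Qed.

(** A product of elements of the other maximal ideals, each taken outside P. *)
Lemma separate_maximal P : maximal_ideal P ->
  exists e, ~ P e /\ forall Q, maximal_ideal Q -> Q <> P -> Q e.
Proof.
move=> maxP; have [s _ sE] := maximal_seq.
have smax Q : Q \in s -> maximal_ideal Q by move/sE.
suff [e [Pe eP]] : exists e, ~ P e /\ forall Q, Q \in s -> Q <> P -> Q e.
  by exists e; split=> // Q /sE; exact: eP.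
elim: s {sE} smax => [|Q s IHs] smax.
  by exists 1; split=> //; exact: maximal1.
have maxQ : maximal_ideal Q by apply: smax; rewrite mem_head.
have [|e [Pe eP]] := IHs.
  by move=> J Js; apply: smax; rewrite inE Js orbT.
have [->|QP] := EM (Q = P).
  by exists e; split=> // J; rewrite inE => /predU1P[->//|]; exact: eP.
have [x Qx Px] : exists2 x, Q x & ~ P x.
  apply: contrapT => /forall2NP QleP; apply: QP; case: maxQ => _ _ Qmax.
  apply/esym/Qmax => [||x Qx]; [exact: maximal_is_ideal|exact: maximal1|].
  by have [//|/contrapT] := QleP x.
exists (x * e); split; first exact: maximalM.
move=> J; rewrite inE => /predU1P[->|Js] JP.
  by apply: idealMr => //; exact: maximal_is_ideal.
by apply: idealMl; [apply/maximal_is_ideal/smax; rewrite inE Js orbT|exact: eP].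
Qed.

(** The weak form of the Chinese remainder theorem by which a single
    coefficient can be adapted to all maximal ideals: add up, over the
    maximal ideals that have to be avoided, elements that lie in all maximal
    ideals but that one. *)
Lemma select_maximal (sel : set R -> Prop) :
  exists r, forall P, maximal_ideal P -> P r <-> sel P.
Proof.
have [s uniqs sE] := maximal_seq.
have /choice[g gP] P : exists e, maximal_ideal P ->
    (P e <-> sel P) /\ forall Q, maximal_ideal Q -> Q <> P -> Q e.
  have [maxP|] := EM (maximal_ideal P); last by exists 0.
  have [selP|nselP] := EM (sel P).
    by exists 0 => _; split=> [|Q maxQ _]; [split=> // _|]; apply: ideal0;
       exact: maximal_is_ideal.
  by have [e [Pe eP]] := separate_maximal maxP; exists e.
exists (\sum_(Q <- s) g Q) => P maxP; have idP := maximal_is_ideal maxP.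
rewrite (bigD1_seq P) //=; last exact/sE.
have [<- _] := gP P maxP; set u := \sum_(_ <- _ | _) _.
have Pu : P u.
  rewrite /u big_seq_cond; elim/big_ind: _ => [|x y|Q /andP[/sE maxQ /eqP QP]].
  - exact: ideal0.
  - exact: idealD.
  - by have [_] := gP Q maxQ; apply=> // /esym.
by split=> [|Pg]; [rewrite addrC; exact: idealDr|exact: idealD].
Qed.

Definition generates_at P K d := K `<=` [set k | ldiv P d k].

(** If s y = t x in R, then s (u x + v y) = (s u + t v) x, so u x + v y
    generates as much as x at P as soon as s u + t v is a unit there. *)
Lemma generates_at_combination P K x y u v s t :
  maximal_ideal P -> is_ideal K -> generates_at P K x -> ~ P s ->
  s * y = t * x -> ~ P (s * u + t * v) -> generates_at P K (u * x + v * y).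
Proof.
move=> maxP idK genx Ps e Pw k Kk; have [s' Ps' [t' e']] := genx k Kk.
exists (s' * (s * u + t * v)); first exact: maximalM.
exists (t' * s).
have -> : s' * (s * u + t * v) * k = (s * u + t * v) * (s' * k) by ring.
have -> : t' * s * (u * x + v * y) = t' * (s * u * x + v * (s * y)) by ring.
by rewrite e e'; ring.
Qed.

(** The coefficient r is taken in P exactly when x has a generating entry
    x_j at P. In that case y_j = t x_j locally and 1 + r t is a unit at P;
    otherwise some y_j generates, x_j = t y_j with t in P, and t + r is a
    unit at P. *)
Lemma row_step K n (x y : 'rV[R]_n) : is_ideal K ->
  (forall j, K (x 0 j)) -> (forall j, K (y 0 j)) ->
  exists r, forall P, maximal_ideal P ->
    (exists j, generates_at P K (x 0 j) \/ generates_at P K (y 0 j)) ->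
    exists j, generates_at P K ((x + r *: y) 0 j).
Proof.
move=> idK Kx Ky.
have [r rP] := select_maximal (fun P => exists j, generates_at P K (x 0 j)).
exists r => P maxP xy.
have xryE j : (x + r *: y) 0 j = 1 * x 0 j + r * y 0 j by rewrite !mxE mul1r.
have idP := maximal_is_ideal maxP.
have [Pr|Pr] := EM (P r).
  have [j genx] := (rP P maxP).1 Pr; exists j.
  have [s Ps [t e]] := genx _ (Ky j); rewrite xryE.
  apply: (generates_at_combination maxP idK genx Ps e).
  rewrite mulr1 addrC => Pw; apply: Ps; apply: (idealDr idP _ Pw).
  exact: idealMl.
have ngenx j : ~ generates_at P K (x 0 j).
  by move=> genx; apply: Pr; apply/rP => //; exists j.
have [j [/ngenx//|geny]] := xy; exists j.
have [s Ps [t e]] := geny _ (Kx j); rewrite xryE addrC.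
apply: (generates_at_combination maxP idK geny Ps e).
have Pt : P t.
  apply: contrapT => Pt; apply: (ngenx j) => k /geny; apply: ldiv_trans => //.
  by exists t => //; exists s.
by rewrite mulr1 addrC => /(idealDr idP Pt); exact: maximalM.
Qed.

Lemma ex_row_combination K m n (A : 'M[R]_(1 + m, n)) : is_ideal K ->
  (forall i j, K (A i j)) ->
  exists r : 'rV_m, forall P, maximal_ideal P ->
    (exists i j, generates_at P K (A i j)) ->
    exists j, generates_at P K ((row_mx 1%:M r *m A) 0 j).
Proof.
move=> idK KA.
suff /(_ m (leqnn m))[r rP] : forall k, (k <= m)%N -> exists r : 'rV[R]_m,
    forall P, maximal_ideal P ->
    (exists (i : 'I_(1 + m)) j, (i <= k)%N /\ generates_at P K (A i j)) ->
    exists j, generates_at P K ((row_mx 1%:M r *m A) 0 j).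
  exists r => P maxP [i [j gen]]; apply: rP => //; exists i, j; split=> //.
  by rewrite -ltnS.
elim=> [_|k IHk lekm].
  exists 0 => P maxP [i [j [i0 gen]]]; exists j.
  rewrite -[A]vsubmxK mul_row_col mul1mx mul0mx addr0 mxE.
  by rewrite (_ : lshift m 0 = i) //; apply/val_inj => /=; case: (val i) i0.
have [r rP] := IHk (ltnW lekm).
pose ik := Ordinal lekm; pose i' : 'I_(1 + m) := rshift 1 ik.
have [||rho rhoP] := row_step (x := row_mx 1%:M r *m A) (y := row i' A) idK.
- move=> j; rewrite mxE; elim/big_ind: _ => [|x y|i _].
  + exact: ideal0.
  + exact: idealD.
  + exact: idealMl.
- by move=> j; rewrite mxE.
exists (r + rho *: delta_mx 0 ik) => P maxP [i [j [lei gen]]].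
have -> : row_mx 1%:M (r + rho *: delta_mx 0 ik) *m A =
    row_mx 1%:M r *m A + rho *: row i' A.
  rewrite -[A]vsubmxK !mul_row_col mulmxDl addrA -scalemxAl -rowE.
  by rewrite vsubmxK; congr (_ + _ *: _); apply/rowP => l; rewrite !mxE.
apply: rhoP => //; move: lei; rewrite leq_eqVlt ltnS => /predU1P[ei|lei].
  exists j; right; rewrite mxE (_ : i' = i) //; apply/val_inj => /=.
  by rewrite ei.
have [|j' gen'] := rP P maxP; first by exists i, j.
by exists j'; left.
Qed.

Lemma ex_ldiv_all P n (x : 'I_n.+1 -> R) : maximal_ideal P ->
  exists j, forall j', ldiv P (x j) (x j').
Proof.
move=> maxP.
have ldivxx a : ldiv P a a by exists 1; [exact: maximal1|exists 1].
suff [j jP] : exists j, forall j', j' \in enum 'I_n.+1 -> ldiv P (x j) (x j').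
  by exists j => j'; apply: jP; rewrite mem_enum.
elim: (enum _) => [|i s [j jP]]; first by exists ord0.
have [ij|ji] := cmpR (x i) (x j) maxP.
  exists i => j'; rewrite inE => /predU1P[->//|/jP]; exact: ldiv_trans.
by exists j => j'; rewrite inE => /predU1P[->//|/jP].
Qed.

(** Rows are combined first, so that the first row contains a generator at
    each maximal ideal, and then columns, which brings these generators
    together in one entry. *)
Lemma ex_pivot m n (A : 'M[R]_(1 + m, 1 + n)) :
  exists (r : 'rV_m) (s : 'cV_n),
    let z := (row_mx 1%:M r *m A *m col_mx 1%:M s) 0 0 in
    forall i j, exists t, A i j = t * z.
Proof.
pose K : set R :=
  fun k => forall I, is_ideal I -> (forall i j, I (A i j)) -> I k.
have idK : is_ideal K.
  split=> [I idI _|x y Kx Ky I idI IA|a x Kx I idI IA]; first exact: ideal0.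
    by apply: idealD; [|exact: Kx|exact: Ky].
  by apply: idealMl => //; exact: Kx.
have KA i j : K (A i j) by move=> I _; exact.
have genA P : maximal_ideal P -> exists i j, generates_at P K (A i j).
  move=> maxP; have /choice[f fP] i := ex_ldiv_all (A i) maxP.
  have [i iP] := ex_ldiv_all (fun i => A i (f i)) maxP.
  exists i, (f i) => k; apply; first exact: ldiv_ideal.
  by move=> i' j; apply: ldiv_trans (iP i') (fP i' j).
have [r rP] := ex_row_combination idK KA.
have [|s sP] := @ex_row_combination K n 1 (row_mx 1%:M r *m A)^T idK.
  move=> i j; rewrite mxE mxE; elim/big_ind: _ => [|x y|l _].
  + exact: ideal0.
  + exact: idealD.
  + exact: (idealMl _ idK (KA _ _)).
exists r, s^T => /= i j; apply: dvd_locally => P maxP.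
have [j' gen] := rP P maxP (genA P maxP).
have [|j''] := sP P maxP; first by exists j', ord0; rewrite mxE ord1.
rewrite ord1 => /(_ _ (KA i j)).
by rewrite -[row_mx _ s]trmxK tr_row_mx trmx1 -trmx_mul mxE.
Qed.

End Semilocal.
End LocalDivisibility.

(** * Periodic matrices and diagonalization *)

Section PeriodicMatrices.
Variable R : comPzRingType.

Definition mximage m n (A : 'M[R]_(m, n)) : set 'rV[R]_n :=
  [set v | exists u, v = u *m A].
Definition mxkernel m n (A : 'M[R]_(m, n)) : set 'rV[R]_m :=
  [set v | v *m A = 0].

(** Matrices act on row vectors on the right. The first three conditions
    make the cokernel of A 2-periodic; the last one is coherence. *)
Definition periodic_mx m n (A : 'M[R]_(m, n)) : Prop :=
  exists (A' B : 'M[R]_n) (C : 'M[R]_m),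
    [/\ mximage A' = mximage A, mxkernel B = mximage A',
        mxkernel A' = mximage B & mxkernel A = mximage C].

Lemma mximage_mull m n p (U : 'M[R]_(m, n)) (V : 'M[R]_(n, m))
    (A : 'M[R]_(n, p)) :
  V *m U = 1%:M -> mximage (U *m A) = mximage A.
Proof.
move=> VU; apply/seteqP; split=> _ [u ->].
  by exists (u *m U); rewrite mulmxA.
by exists (u *m V); rewrite mulmxA -(mulmxA u) VU mulmx1.
Qed.

Lemma mximage_mulr m n p (A : 'M[R]_(m, n)) (U : 'M[R]_(n, p))
    (V : 'M[R]_(p, n)) v :
  U *m V = 1%:M -> V *m U = 1%:M -> mximage A (v *m V) <-> mximage (A *m U) v.
Proof.
move=> UV VU; split=> [[u e]|[u ->]]; exists u.
  by rewrite mulmxA -e -mulmxA VU mulmx1.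
by rewrite -!mulmxA UV mulmx1.
Qed.

Lemma mxkernel_mulr m n p (A : 'M[R]_(m, n)) (U : 'M[R]_(n, p))
    (V : 'M[R]_(p, n)) :
  U *m V = 1%:M -> mxkernel (A *m U) = mxkernel A.
Proof.
move=> UV; apply/seteqP; split=> v; rewrite /mxkernel /= mulmxA.
  by move=> e; rewrite -[LHS]mulmx1 -UV mulmxA e mul0mx.
by move->; exact: mul0mx.
Qed.

Lemma mxkernel_mull m n p (U : 'M[R]_(m, n)) (A : 'M[R]_(n, p)) v :
  mxkernel (U *m A) v <-> mxkernel A (v *m U).
Proof. by rewrite /mxkernel /= mulmxA. Qed.

Lemma periodic_mx_equiv m n (P P' : 'M[R]_m) (Q Q' : 'M[R]_n) A :
  P *m P' = 1%:M -> P' *m P = 1%:M -> Q *m Q' = 1%:M -> Q' *m Q = 1%:M ->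
  periodic_mx (P *m A *m Q) -> periodic_mx A.
Proof.
move=> PP' P'P QQ' Q'Q [A' [B [C [imA' kerB kerA' kerA]]]].
have imA : mximage (P *m A *m Q) = mximage (A *m Q).
  by rewrite -mulmxA (mximage_mull _ P'P).
have kerPA : mxkernel (P *m A *m Q) = mxkernel (P *m A).
  by rewrite (mxkernel_mulr _ QQ').
exists (A' *m Q'), (Q *m B), (C *m P); split.
- apply/seteqP; split=> v.
    move=> /(mximage_mulr _ _ Q'Q QQ'); rewrite imA' imA.
    by move=> /(mximage_mulr _ _ QQ' Q'Q); rewrite -mulmxA QQ' mulmx1.
  move=> Av; apply/(mximage_mulr _ _ Q'Q QQ'); rewrite imA' imA.
  by apply/(mximage_mulr _ _ QQ' Q'Q); rewrite -mulmxA QQ' mulmx1.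
- apply/seteqP; split=> v.
    by move=> /mxkernel_mull; rewrite kerB => /(mximage_mulr _ _ Q'Q QQ').
  by move=> /(mximage_mulr _ _ Q'Q QQ'); rewrite -kerB => /mxkernel_mull.
- by rewrite (mxkernel_mulr _ Q'Q) kerA' (mximage_mull _ Q'Q).
- apply/seteqP; split=> v.
    move=> Av; apply/(mximage_mulr _ _ PP' P'P); rewrite -kerA kerPA.
    by apply/mxkernel_mull; rewrite -mulmxA P'P mulmx1.
  move=> /(mximage_mulr _ _ PP' P'P); rewrite -kerA kerPA => /mxkernel_mull.
  by rewrite -mulmxA P'P mulmx1.
Qed.

Lemma mximage_block m1 m2 n1 n2 (A : 'M[R]_(m1, n1)) (D : 'M[R]_(m2, n2)) :
  mximage (block_mx A 0 0 D) =
  [set v | mximage A (lsubmx v) /\ mximage D (rsubmx v)].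
Proof.
apply/seteqP; split=> v /=.
  move=> [u ->]; rewrite -[u]hsubmxK mul_row_block !mulmx0 addr0 add0r.
  by rewrite row_mxKl row_mxKr; split; [exists (lsubmx u)|exists (rsubmx u)].
move=> [[u uE] [w wE]]; exists (row_mx u w).
by rewrite mul_row_block !mulmx0 addr0 add0r -uE -wE hsubmxK.
Qed.

Lemma mxkernel_block m1 m2 n1 n2 (A : 'M[R]_(m1, n1)) (D : 'M[R]_(m2, n2)) :
  mxkernel (block_mx A 0 0 D) =
  [set v | mxkernel A (lsubmx v) /\ mxkernel D (rsubmx v)].
Proof.
have blockE v : v *m block_mx A 0 0 D = row_mx (lsubmx v *m A) (rsubmx v *m D).
  by rewrite -{1}[v]hsubmxK mul_row_block !mulmx0 addr0 add0r.
apply/seteqP; split=> v; rewrite /mxkernel /= blockE.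
  by rewrite -row_mx0 => /eq_row_mx.
by move=> [-> ->]; rewrite row_mx0.
Qed.

Lemma periodic_mx_block m1 m2 n1 n2 (A : 'M[R]_(m1, n1)) (D : 'M[R]_(m2, n2)) :
  periodic_mx A -> periodic_mx D -> periodic_mx (block_mx A 0 0 D).
Proof.
move=> [A1 [B1 [C1 [e1 e2 e3 e4]]]] [A2 [B2 [C2 [f1 f2 f3 f4]]]].
exists (block_mx A1 0 0 A2), (block_mx B1 0 0 B2), (block_mx C1 0 0 C2).
by rewrite !mximage_block !mxkernel_block e1 e2 e3 e4 f1 f2 f3 f4 e1 f1.
Qed.

Definition annihilator d : set R := [set r | r * d = 0].
Definition multiples d : set R := [set r | exists t, r = t * d].
Definition periodic_elements :=
  forall d, exists c,
    annihilator c = multiples d /\ annihilator d = multiples c.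

Lemma mximage_scalar (d : R) :
  mximage (d%:M : 'M_1) = [set v | multiples d (v 0 0)].
Proof.
apply/seteqP; split=> v /=.
  move=> [u ->]; exists (u 0 0).
  by rewrite -scalemx1 -scalemxAr mulmx1 mxE mulrC.
move=> [t e]; exists t%:M; apply/rowP => j; rewrite ord1 e.
by rewrite -scalar_mxM mxE mulr1n.
Qed.

Lemma mxkernel_scalar (d : R) :
  mxkernel (d%:M : 'M_1) = [set v | annihilator d (v 0 0)].
Proof.
apply/seteqP; split=> v; rewrite /mxkernel /annihilator /= mul_mx_scalar.
  by move=> /(congr1 (fun w : 'rV_1 => w 0 0)); rewrite !mxE mulrC.
by move=> e; apply/rowP => j; rewrite ord1 !mxE mulrC.
Qed.

Lemma periodic_mx_scalar d : periodic_elements -> periodic_mx (d%:M : 'M_1).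
Proof.
move=> /(_ d)[c [annc annd]]; exists d%:M, c%:M, c%:M.
by rewrite !mximage_scalar !mxkernel_scalar annc annd.
Qed.

Lemma periodic_mx0rows n (A : 'M[R]_(0, n)) : periodic_mx A.
Proof.
exists 0, 1%:M, 1%:M; split; apply/seteqP; split=> v.
all: rewrite /mxkernel /mximage /=.
- by move=> [u ->]; exists 0; rewrite mulmx0 mul0mx.
- by move=> [u ->]; exists 0; rewrite [u]thinmx0 !mul0mx.
- by rewrite mulmx1 => ->; exists 0; rewrite mul0mx.
- by move=> [u ->]; rewrite mulmx0 mul0mx.
- by move=> _; exists v; rewrite mulmx1.
- by rewrite mulmx0.
- by move=> _; exists v; rewrite mulmx1.
- by rewrite [v]thinmx0 mul0mx.
Qed.

Lemma periodic_mx0cols m (A : 'M[R]_(m, 0)) : periodic_mx A.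
Proof.
exists 0, 0, 1%:M; split; apply/seteqP; split=> v.
all: rewrite /mxkernel /mximage /= => _.
all: by [rewrite thinmx0|exists 0; rewrite [v]thinmx0 [RHS]thinmx0
        |exists v; rewrite mulmx1].
Qed.

Section Diagonalization.
Hypothesis semiR : semilocal R.
Hypothesis cmpR : locally_comparable R.
Hypothesis perR : periodic_elements.

Lemma transvection_lK m n (V : 'M[R]_(m, n)) :
  block_mx 1%:M 0 V 1%:M *m block_mx 1%:M 0 (- V) 1%:M = 1%:M.
Proof.
rewrite mulmx_block !mulmx0 !mul0mx !mul1mx !mulmx1 !addr0 add0r subrr.
by rewrite -scalar_mx_block.
Qed.

Lemma transvection_uK m n (V : 'M[R]_(m, n)) :
  block_mx 1%:M V 0 1%:M *m block_mx 1%:M (- V) 0 1%:M = 1%:M.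
Proof.
rewrite mulmx_block !mulmx0 !mul0mx !mul1mx !mulmx1 !addr0 add0r addNr.
by rewrite -scalar_mx_block.
Qed.

(** The pivot divides its row and its column, which transvections clear. *)
Lemma periodic_mx_pivot m n z (X : 'M[R]_(1, n)) (Y : 'M[R]_(m, 1))
    (W : 'M[R]_(m, n)) :
  (forall D : 'M_(m, n), periodic_mx D) ->
  periodic_mx (block_mx z%:M (z *: X) (z *: Y) W).
Proof.
move=> perD.
apply: (@periodic_mx_equiv _ _
  (block_mx 1%:M 0 (- Y) 1%:M) (block_mx 1%:M 0 Y 1%:M)
  (block_mx 1%:M (- X) 0 1%:M) (block_mx 1%:M X 0 1%:M)).
- by rewrite -{2}[Y]opprK transvection_lK.
- exact: transvection_lK.
- by rewrite -{2}[X]opprK transvection_uK.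
- exact: transvection_uK.
rewrite !mulmx_block !mulmx0 !mul0mx !mul1mx !mulmx1 !addr0.
rewrite mul_scalar_mx scalerN addNr mulNmx mul_mx_scalar addNr mul0mx add0r.
exact/periodic_mx_block/perD/periodic_mx_scalar.
Qed.

Lemma ulsubmx_transvections m n (r : 'rV[R]_m) (s : 'cV_n)
    (A : 'M_(1 + m, 1 + n)) :
  ulsubmx (block_mx 1%:M r 0 1%:M *m A *m block_mx 1%:M 0 s 1%:M) =
  row_mx 1%:M r *m A *m col_mx 1%:M s.
Proof.
rewrite -[A]submxK !mulmx_block mul_row_block mul_row_col block_mxKul.
by rewrite !mulmx1.
Qed.

(** The pivot divides all of A, hence all of the transformed matrix, whose
    first row and column therefore have the form z X and z Y. *)
Lemma all_periodic_mx m n (A : 'M[R]_(m, n)) : periodic_mx A.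
Proof.
elim: m n A => [|m IHm] n A; first exact: periodic_mx0rows.
case: n A => [|n] A; first exact: periodic_mx0cols.
have [r [s]] := ex_pivot semiR cmpR (A : 'M_(1 + m, 1 + n)).
set z := (_ *m _) 0 0 => /= zA.
have [A1 A1E] : exists A1 : 'M_(1 + m, 1 + n), A = z *: A1.
  have /choice[f fP] ij := zA ij.1 ij.2.
  exists (\matrix_(i, j) f (i, j)); apply/matrixP => i j.
  by rewrite !mxE mulrC -fP.
apply: (@periodic_mx_equiv _ _
  (block_mx 1%:M r 0 1%:M) (block_mx 1%:M (- r) 0 1%:M)
  (block_mx 1%:M 0 s 1%:M) (block_mx 1%:M 0 (- s) 1%:M)).
- exact: transvection_uK.
- by rewrite -{2}[r]opprK transvection_uK.
- exact: transvection_lK.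
- by rewrite -{2}[s]opprK transvection_lK.
set B := _ *m _ *m _.
pose B1 := block_mx 1%:M r 0 1%:M *m A1 *m block_mx 1%:M 0 s 1%:M.
have BE : B = block_mx (z *: ulsubmx B1) (z *: ursubmx B1)
    (z *: dlsubmx B1) (z *: drsubmx B1).
  by rewrite -scale_block_mx submxK /B {1}A1E -scalemxAr -scalemxAl.
rewrite BE -[z *: ulsubmx _](block_mxKul _ (z *: ursubmx B1)
  (z *: dlsubmx B1) (z *: drsubmx B1)) -BE ulsubmx_transvections.
rewrite [_ *m col_mx _ _]mx11_scalar.
exact/periodic_mx_pivot/IHm.
Qed.

End Diagonalization.

End PeriodicMatrices.

(** * Annihilators of principal ideals *)

Section PeriodicElements.
Variable R : comPzRingType.

Definition finitely_annihilated (d : R) :=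
  exists cs : seq R,
    forall r, multiples d r <-> forall c, c \in cs -> r * c = 0.

Hypothesis semiR : semilocal R.
Hypothesis cmpR : locally_comparable R.

(** A pivot of the row of the cs is a generator of the ideal that they span.
    The row is one entry longer than cs, the last entry being 0, so that it
    is not empty. *)
Lemma principal_annihilator (cs : seq R) :
  exists z, forall r, (forall c, c \in cs -> r * c = 0) <-> annihilator z r.
Proof.
pose A : 'M[R]_(1 + 0, 1 + size cs) := \matrix_(i, j) nth 0 cs j.
have [u [w /= zA]] := ex_pivot semiR cmpR A.
exists ((row_mx 1%:M u *m A *m col_mx 1%:M w) 0 0) => r; split=> [rcs|rz c].
  have rA : r *: A = 0.
    apply/matrixP => i j; rewrite !mxE; have [ltj|lej] := ltnP j (size cs).
      by apply/rcs/mem_nth.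
    by rewrite nth_default ?mulr0.
  have : (r *: (row_mx 1%:M u *m A *m col_mx 1%:M w)) 0 0 = 0.
    by rewrite scalemxAl scalemxAr rA mulmx0 mul0mx mxE.
  by rewrite mxE.
move=> /(nthP 0)[i lti <-]; have ltiS : (i < 1 + size cs)%N by apply: ltnW.
have [t] := zA 0 (Ordinal ltiS); rewrite {1}mxE /= => ->.
by rewrite mulrCA rz mulr0.
Qed.

(** If R d = ann c and R c = ann c', then c' kills c, hence is a multiple of
    d, so all that kills d kills c' and is in ann c' = R c. *)
Lemma ex_periodic_elements :
  (forall d, finitely_annihilated d) -> periodic_elements R.
Proof.
move=> fann; have prin (d : R) : exists c : R, annihilator c = multiples d.
  have [cs csP] := fann d; have [z zP] := principal_annihilator cs.
  exists z; apply/seteqP; split=> r; first by move/zP/csP.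
  by move/csP/zP.
move=> d; have [c annc] := prin d; exists c; split=> //.
have [c' annc'] := prin c; have cd : d * c = 0.
  have : annihilator c d by rewrite annc; exists 1; rewrite mul1r.
  by [].
apply/seteqP; split=> [r rd|_ [t ->]]; last first.
  by rewrite /annihilator /= -mulrA [c * d]mulrC cd mulr0.
rewrite -annc'; have : annihilator c c'.
  have : annihilator c' c by rewrite annc'; exists 1; rewrite mul1r.
  by rewrite /annihilator /= mulrC.
by rewrite annc => -[t ->]; rewrite /annihilator /= mulrCA rd mulr0.
Qed.

End PeriodicElements.

(** * Two-periodicity of finitely presented modules *)

Section FreeModules.
Variables (R : comPzRingType).

Lemma linear_of_family (V : lmodType R) n (x : 'I_n -> V) :
  exists f : {linear 'rV[R]_n -> V}, forall v, f v = \sum_j v 0 j *: x j.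
Proof.
apply: (@linear_of R _ V) => a u v; rewrite scaler_sumr -big_split /=.
by apply: eq_bigr => j _; rewrite !mxE scalerDl scalerA.
Qed.

Lemma linear_rowE (V : lmodType R) n (f : {linear 'rV[R]_n -> V}) v :
  f v = \sum_j v 0 j *: f (delta_mx 0 j).
Proof.
rewrite {1}[v]row_sum_delta linear_sum.
by apply: eq_bigr => j _; rewrite linearZ.
Qed.

Lemma projective_row n : projective 'rV[R]_n.
Proof.
move=> A B g f /choice[k gk].
have [h hE] := linear_of_family (fun j => k (f (delta_mx 0 j))).
exists h => v; rewrite hE linear_sum [RHS]linear_rowE.
by apply: eq_bigr => j _; rewrite linearZ gk.
Qed.

End FreeModules.

(** The resolution is 0 -> M -> R^n -> R^n -> M -> 0 with maps B and A',
    where M is the cokernel of A. *)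
Lemma periodic_mx_two_semiregular (R : comPzRingType) :
  (forall m n (A : 'M[R]_(m, n)), periodic_mx A) -> two_semiregular R.
Proof.
move=> perA M [m [n [g [f [gf surjf]]]]].
have [A' [B [_ [imA' kerB kerA' _]]]] := perA _ _ (lin1_mx g).
have f0 v : f v = 0 <-> mxkernel B v.
  rewrite kerB imA' gf; split=> -[u uE]; exists u; first by rewrite mul_rV_lin1.
  by rewrite uE mul_rV_lin1.
have [i iE] : exists i : {linear M -> 'rV[R]_n}, forall u, i (f u) = u *m B.
  by apply: (factor_linear (h := mulmxr B)) => // u /f0.
exists 'rV[R]_n, 'rV[R]_n, i, (mulmxr A'), f; split=> //.
- by split; exact: projective_row.
- move=> x y ixy; apply/eqP; rewrite -subr_eq0; apply/eqP.
  have [v vE] := surjf (x - y); rewrite -vE; apply/f0.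
  by rewrite /mxkernel /= -iE vE linearB ixy subrr.
- move=> y /=; rewrite -[_ = 0]/(mxkernel A' y) kerA'; split=> [[u ->]|[x <-]].
    by exists (f u); rewrite iE.
  by have [u <-] := surjf x; exists u; rewrite iE.
- move=> y; rewrite f0 kerB; split=> -[u uE]; exists u; exact/esym.
Qed.

(** * The equational criterion for flatness *)

Lemma zip_map2 (S T S' T' : Type) (f : S -> S') (g : T -> T') s t :
  zip (map f s) (map g t) = [seq (f p.1, g p.2) | p <- zip s t].
Proof. by elim: s t => [|x s IHs] [|y t] //=; rewrite IHs. Qed.

Section EquationalFlatness.
Variables (R : comPzRingType) (F : lmodType R).

(** Finitely many linear relations between elements of F hold because these
    elements are combinations of others for which the coefficients satisfy
    the relations; that is, a map from a finitely presented module to F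
    factors through a free module of finite rank. *)
Definition equationally_flat :=
  forall q (y : {linear 'rV[R]_q -> F}) k (W : 'M_(k, q)),
    (forall i, y (row i W) = 0) ->
    exists p (G : 'M_(q, p)) (z : {linear 'rV[R]_p -> F}),
      W *m G = 0 /\ forall v, y v = z (v *m G).

(** The tensor of the b_i with the v_i, as an element of B^q identified with
    the tensor product of B and R^q. *)
Definition coefs (B : lmodType R) q (bs : seq B) (vs : seq 'rV[R]_q)
    (j : 'I_q) : B :=
  \sum_(p <- zip bs vs) p.2 0 j *: p.1.

Lemma coefs_mul (B : lmodType R) q p (G : 'M_(q, p)) (bs : seq B) vs k :
  coefs bs [seq v *m G | v <- vs] k = \sum_j G j k *: coefs bs vs j.
Proof.
rewrite /coefs; under [RHS]eq_bigr do rewrite scaler_sumr.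
rewrite [RHS]exchange_big /= -[bs in LHS]map_id zip_map2 big_map.
apply: eq_bigr => -[b v] _ /=; rewrite mxE scaler_suml.
by apply: eq_bigr => j _; rewrite mulrC scalerA.
Qed.

Lemma coefs_cat (B : lmodType R) q (bs cs : seq B) (vs ws : seq 'rV[R]_q) j :
  size bs = size vs ->
  coefs (bs ++ cs) (vs ++ ws) j = coefs bs vs j + coefs cs ws j.
Proof. by move=> e; rewrite /coefs zip_cat // big_cat. Qed.

Lemma coefs_map (A B : lmodType R) (f : {linear A -> B}) q (bs : seq A)
    (vs : seq 'rV[R]_q) j :
  coefs [seq f b | b <- bs] vs j = f (coefs bs vs j).
Proof.
rewrite /coefs -[vs in LHS]map_id zip_map2 big_map linear_sum.
by apply: eq_bigr => p _; rewrite linearZ.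
Qed.

Lemma ex_lift (l : seq F) :
  exists q (y : {linear 'rV[R]_q -> F}) vs, [seq y v | v <- vs] = l.
Proof.
have [y yE] := linear_of_family (fun i : 'I_(size l) => tnth (in_tuple l) i).
exists (size l), y, [seq delta_mx 0 i | i <- enum 'I_(size l)].
rewrite -map_comp -[RHS](map_tnth_enum (in_tuple l)).
apply: eq_map => i /=; rewrite yE (bigD1 i) //= !mxE !eqxx scale1r.
rewrite big1 ?addr0 // => j ji; rewrite !mxE /=.
by rewrite (negPf ji) scale0r.
Qed.

(** Two formal sums are the images, under some y : R^q -> F, of the same
    element of the tensor product of B and R^q. For an equationally flat F
    this characterizes equality of tensors; being a statement about families
    in B, it goes through any injection into B. *)
Definition same_coefs (B : lmodType R) (s t : seq (B * F)) :=
  exists q (y : {linear 'rV[R]_q -> F}) vs ws,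
    [/\ [seq y v | v <- vs] = unzip2 s, [seq y w | w <- ws] = unzip2 t &
        forall j, coefs (unzip1 s) vs j = coefs (unzip1 t) ws j].

Lemma coefs_cons (B : lmodType R) q (b : B) (bs : seq B) (v : 'rV[R]_q) vs j :
  coefs (b :: bs) (v :: vs) j = v 0 j *: b + coefs bs vs j.
Proof. by rewrite /coefs /= big_cons. Qed.

Lemma coefs0 (B : lmodType R) q (vs : seq 'rV[R]_q) j :
  coefs ([::] : seq B) vs j = 0.
Proof. by rewrite /coefs; case: vs => [|? ?]; rewrite big_nil. Qed.

Lemma join_linear q1 q2 (y1 : {linear 'rV[R]_q1 -> F})
    (y2 : {linear 'rV[R]_q2 -> F}) :
  exists (y : {linear 'rV[R]_(q1 + q2) -> F}),
    (forall v, y1 v = y (v *m row_mx 1%:M 0)) /\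
    (forall v, y2 v = y (v *m row_mx 0 1%:M)).
Proof.
have [y yE] : exists y : {linear 'rV[R]_(q1 + q2) -> F},
    y =1 fun v => y1 (lsubmx v) + y2 (rsubmx v).
  apply: linear_of => a u v /=.
  by rewrite !linearP scalerDr addrACA.
exists y; split=> v; rewrite yE mul_mx_row mulmx0 mulmx1 row_mxKl row_mxKr.
  by rewrite linear0 addr0.
by rewrite linear0 add0r.
Qed.

Hypothesis flatF : equationally_flat.

(** The intermediate sum t is written in two ways over R^(q1 + q2). The
    differences are relations in F, and the equational criterion provides a
    change of coordinates G that makes the two ways equal. *)
Lemma same_coefs_trans (B : lmodType R) (s t u : seq (B * F)) :
  same_coefs s t -> same_coefs t u -> same_coefs s u.
Proof.
move=> [q1 [y1 [vs [ws [ys yt cst]]]]] [q2 [y2 [ws' [us [yt' yu ctu]]]]].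
have [y [yE1 yE2]] := join_linear y1 y2.
pose W := \matrix_(i < size t)
  (nth 0 ws i *m row_mx 1%:M 0 - nth 0 ws' i *m row_mx 0 1%:M
   : 'rV[R]_(q1 + q2)).
have szw : size ws = size t by rewrite -(size_map y1) yt size_map.
have szw' : size ws' = size t by rewrite -(size_map y2) yt' size_map.
have [i|p [G [z [WG yE]]]] := @flatF _ y _ W.
  rewrite rowK linearB -yE1 -yE2 -(nth_map 0 0) ?szw //.
  by rewrite -(nth_map 0 0 y2) ?szw' // yt yt' subrr.
exists p, z, [seq v *m (row_mx 1%:M 0 *m G) | v <- vs],
  [seq v *m (row_mx 0 1%:M *m G) | v <- us]; split.
- by rewrite -ys -map_comp; apply: eq_map => v /=; rewrite yE1 yE mulmxA.
- by rewrite -yu -map_comp; apply: eq_map => v /=; rewrite yE2 yE mulmxA.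
move=> k; transitivity
    (coefs (unzip1 t) [seq v *m (row_mx 1%:M 0 *m G) | v <- ws] k).
  by rewrite !coefs_mul; apply: eq_bigr => j _; rewrite cst.
transitivity
    (coefs (unzip1 t) [seq v *m (row_mx 0 1%:M *m G) | v <- ws'] k); last first.
  by rewrite !coefs_mul; apply: eq_bigr => j _; rewrite ctu.
congr coefs.
apply: (@eq_from_nth _ 0) => [|i]; rewrite !size_map szw ?szw' // => lti.
rewrite !(nth_map 0) ?szw ?szw' // !mulmxA.
apply/eqP; rewrite -subr_eq0 -mulmxBl.
by have := congr1 (row (Ordinal lti)) WG; rewrite row_mul rowK row0 => ->.
Qed.

Lemma tensor_same_coefs (B : lmodType R) (s t : seq (B * F)) :
  tensor_eq s t -> same_coefs s t.
Proof.
elim=> {s t}.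
- move=> s; have [q [y [vs yE]]] := ex_lift (unzip2 s).
  by exists q, y, vs, vs.
- move=> s t _ [q [y [vs [ws [ys yt c]]]]].
  by exists q, y, ws, vs; split=> // j; rewrite c.
- move=> s t u _ st _; exact: same_coefs_trans.
- move=> s s' t t' _ [q1 [y1 [vs1 [ws1 [ys1 yt1 c1]]]]].
  move=> _ [q2 [y2 [vs2 [ws2 [ys2 yt2 c2]]]]].
  have [y [yE1 yE2]] := join_linear y1 y2.
  exists (q1 + q2)%N, y,
    ([seq v *m row_mx 1%:M 0 | v <- vs1] ++
     [seq v *m row_mx 0 1%:M | v <- vs2]),
    ([seq v *m row_mx 1%:M 0 | v <- ws1] ++
     [seq v *m row_mx 0 1%:M | v <- ws2]).
  split.
  + rewrite [RHS]map_cat -[map _ s]/(unzip2 s) -[map _ t]/(unzip2 t).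
    rewrite -ys1 -ys2 map_cat -!map_comp.
    by congr (_ ++ _); apply: eq_map => v /=.
  + rewrite [RHS]map_cat -[map _ s']/(unzip2 s') -[map _ t']/(unzip2 t').
    rewrite -yt1 -yt2 map_cat -!map_comp.
    by congr (_ ++ _); apply: eq_map => v /=.
  + move=> j; rewrite /unzip1 !map_cat !coefs_cat ?size_map.
    * rewrite !coefs_mul.
      by congr (_ + _); apply: eq_bigr => k _; rewrite ?c1 ?c2.
    * by rewrite -(size_map y1) yt1 size_map.
    * by rewrite -(size_map y1) ys1 size_map.
- move=> s t; have [q [y [us yE]]] := ex_lift (unzip2 s ++ unzip2 t).
  exists q, y, us, (drop (size s) us ++ take (size s) us).
  have szus : size us = (size s + size t)%N.
    by rewrite -(size_map y) yE size_cat !size_map.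
  split; first by rewrite yE /unzip2 map_cat.
    rewrite map_cat map_take map_drop yE drop_size_cat ?size_map //.
    by rewrite take_size_cat ?size_map // /unzip2 map_cat.
  move=> j; rewrite -{1}[us](cat_take_drop (size s)) /unzip1 !map_cat.
  rewrite !coefs_cat; first exact: addrC.
    by rewrite size_drop szus addKn size_map.
  by rewrite size_takel ?size_map // szus leq_addr.
- move=> m; have [q [y [[|v []] //= [yE]]]] := ex_lift [:: m].
  exists q, y, [:: v], [::]; split=> //=; first by rewrite yE.
  by move=> j; rewrite coefs_cons !coefs0 addr0 scaler0.
- move=> a; have [q [y _]] := ex_lift [::].
  exists q, y, [:: 0], [::]; split=> //=; first by rewrite linear0.
  by move=> j; rewrite coefs_cons !coefs0 addr0 mxE scale0r.
- move=> a b m; have [q [y [[|v []] //= [yE]]]] := ex_lift [:: m].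
  exists q, y, [:: v], [:: v; v]; split=> //=; rewrite ?yE // => j.
  by rewrite !coefs_cons !coefs0 !addr0 scalerDr.
- move=> a m n; have [q [y [[|v [|w []]] //= [yE1 yE2]]]] := ex_lift [:: m; n].
  exists q, y, [:: v + w], [:: v; w]; split=> //=.
  + by rewrite linearD yE1 yE2.
  + by rewrite yE1 yE2.
  + by move=> j; rewrite !coefs_cons !coefs0 !addr0 mxE scalerDl.
- move=> r a m; have [q [y [[|v []] //= [yE]]]] := ex_lift [:: m].
  exists q, y, [:: v], [:: r *: v]; split=> //=; rewrite ?linearZ ?yE // => j.
  by rewrite !coefs_cons !coefs0 !addr0 mxE scalerA mulrC.
Qed.

Definition canonical_tensor (B : lmodType R) q (y : {linear 'rV[R]_q -> F})
    (c : 'I_q -> B) : seq (B * F) :=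
  [seq (c j, y (delta_mx 0 j)) | j <- enum 'I_q].

Lemma tensor_eq_sum_r (B : lmodType R) (b : B) (I : Type) (s : seq I)
    (x : I -> F) :
  tensor_eq [:: (b, \sum_(i <- s) x i)] [seq (b, x i) | i <- s].
Proof.
elim: s => [|i s IHs]; first by rewrite big_nil; exact: tensor_0r.
rewrite big_cons; apply: tensor_trans (tensor_Dr _ _ _) _.
exact: (tensor_cat (s := [:: _]) (s' := [:: _]) (tensor_refl _) IHs).
Qed.

Lemma canonical_tensorD (B : lmodType R) q (y : {linear 'rV[R]_q -> F})
    (c d : 'I_q -> B) :
  tensor_eq (canonical_tensor y (fun j => c j + d j))
    (canonical_tensor y c ++ canonical_tensor y d).
Proof.
rewrite /canonical_tensor; elim: (enum _) => [|j s IHs] /=.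
  exact: tensor_refl.
apply: tensor_trans (tensor_cat (s := [:: _]) (tensor_Dl _ _ _) IHs) _ => /=.
set S1 := map _ s; set S2 := map _ s.
apply: (tensor_cat (s := [:: _]) (s' := [:: _]) (tensor_refl _)).
rewrite -cat1s -(cat1s _ S2) !catA.
by apply: tensor_cat (tensor_catC _ _) (tensor_refl _).
Qed.

(** Expanding each vector in the standard basis and collecting the
    coefficients shows that a formal sum depends, up to tensor equality, on
    its [coefs] only. *)
Lemma tensor_eq_canonical (B : lmodType R) q (y : {linear 'rV[R]_q -> F})
    (s : seq (B * F)) vs :
  [seq y v | v <- vs] = unzip2 s ->
  tensor_eq s (canonical_tensor y (coefs (unzip1 s) vs)).
Proof.
elim: s vs => [|[b x] s IHs] [|v vs] //= => [_|[<- /IHs{}IHs]].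
  rewrite /canonical_tensor; elim: (enum _) => [|j e IHe].
    exact: tensor_refl.
  rewrite /= coefs0 -[X in tensor_eq X]/([::] ++ [::]) -cat1s.
  by apply: tensor_cat IHe; apply: tensor_sym; exact: tensor_0l.
have -> : coefs (b :: unzip1 s) (v :: vs) =
    fun j => v 0 j *: b + coefs (unzip1 s) vs j.
  by apply/funext => j; rewrite /coefs /= big_cons.
apply: tensor_trans (tensor_sym (canonical_tensorD _ _ _)).
rewrite -cat1s; apply: tensor_cat IHs.
rewrite linear_rowE; apply: tensor_trans (tensor_eq_sum_r _ _ _) _.
rewrite /canonical_tensor /index_enum -enumT; elim: (enum _) => [|j e IHe] /=.
  exact: tensor_refl.
rewrite -cat1s -[X in tensor_eq _ X]cat1s; apply: tensor_cat IHe.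
by apply: tensor_sym; exact: tensor_Z.
Qed.

Lemma equationally_flat_flat : flat F.
Proof.
move=> A B f injf x y; rewrite -[x]reprK -[y]reprK !tensor_map_pi.
move: (repr x) (repr y) => {x y} s t.
move=> /eqP/eq_tensorP/tensor_same_coefs[q [y [vs [ws [ys yt c]]]]].
have unzip2E (u : seq (A * F)) : unzip2 (tensor_map_seq f u) = unzip2 u.
  by rewrite /unzip2 -map_comp.
have unzip1E (u : seq (A * F)) : unzip1 (tensor_map_seq f u) = map f (unzip1 u).
  by rewrite /unzip1 -!map_comp.
rewrite !unzip2E in ys yt; apply/eqP/eq_tensorP.
apply: tensor_trans (tensor_eq_canonical ys) _.
apply: tensor_trans (tensor_sym (tensor_eq_canonical yt)).
rewrite (_ : coefs (unzip1 s) vs = coefs (unzip1 t) ws).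
  exact: tensor_refl.
by apply/funext => j; apply: injf; rewrite -!coefs_map -!unzip1E.
Qed.

End EquationalFlatness.

(** * Embedding a module in a flat module *)

Section ReducedPower.
Variables (R : comPzRingType) (M : lmodType R).

(** A triple (r, m, m') stands for the linear relation between m, m' and r m
    + m', which h is asked to preserve. *)
Definition respects (L : seq (R * M * M)) (h : M -> R) :=
  forall t, t \in L -> h (t.1.1 *: t.1.2 + t.2) = t.1.1 * h t.1.2 + h t.2.

Lemma respects_sub L L' h : {subset L <= L'} -> respects L' h -> respects L h.
Proof. by move=> LL' L'h t /LL'; exact: L'h. Qed.

(** The kernel of the reduced power: elements of R^(M -> R) that vanish at
    all functions that preserve enough relations. The linear maps M -> R
    preserve all of them, but there may be too few of these to separate the
    elements of M. *)
Definition eventually_zero : set ((M -> R) -> R^o) :=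
  [set f | exists L, forall h, respects L h -> f h = 0].

Lemma eventually_zero_submodule : is_submodule eventually_zero.
Proof.
split=> [|f g [L fL] [L' gL']|a f [L fL]].
- by exists [::].
- exists (L ++ L') => h hL; rewrite fctE fL ?gL' ?addr0 //.
    by apply: respects_sub hL => t tL'; rewrite mem_cat tL' orbT.
  by apply: respects_sub hL => t tL; rewrite mem_cat tL.
- by exists L => h /fL; rewrite fctE => ->; rewrite scaler0.
Qed.

Hypothesis perR : forall m n (A : 'M[R]_(m, n)), periodic_mx A.

(** The finitely many elements S and relations L define a finitely presented
    module N with a map to M. As the cokernel of a periodic matrix, N embeds
    in some R^n by a matrix B. Each coordinate of this embedding, extended
    to M by 0 outside S, respects L. So if they all kill m, the element of N
    that stands for m is zero, and m is zero too. *)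
Lemma respecting_separates (L : seq (R * M * M)) (m : M) :
  (forall h, respects L h -> h m = 0) -> m = 0.
Proof.
move=> Lm.
pose S := undup
  (m :: flatten [seq [:: t.1.2; t.2; t.1.1 *: t.1.2 + t.2] | t <- L]).
pose eps (x : M) : 'rV[R]_(size S) := \row_j (x == nth 0 S j)%:R.
have [ev evE] := linear_of_family (fun j : 'I_(size S) => nth 0 S j).
have evK x : x \in S -> ev (eps x) = x.
  move=> xS; have ltx : (index x S < size S)%N by rewrite index_mem.
  rewrite evE (bigD1 (Ordinal ltx)) //= mxE /= nth_index // eqxx scale1r.
  rewrite big1 ?addr0 // => j jx; rewrite mxE.
  case: eqP => [xj|_]; last by rewrite scale0r.
  case/negP: jx; apply/eqP/val_inj => /=.
  by rewrite xj index_uniq // undup_uniq.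
pose rel (t : R * M * M) :=
  t.1.1 *: eps t.1.2 + eps t.2 - eps (t.1.1 *: t.1.2 + t.2).
have [A' [B [_ [imA' kerB _ _]]]] :=
  perR (\matrix_(i < size L) rel (nth (0, 0, 0) L i)).
have relS t : t \in L -> ev (rel t) = 0.
  move=> tL; have tS x : x \in [:: t.1.2; t.2; t.1.1 *: t.1.2 + t.2] -> x \in S.
    move=> xt; rewrite mem_undup inE; apply/orP; right; apply/flattenP.
    by eexists; [apply: map_f tL|].
  rewrite /rel linearB linearD linearZ !evK ?subrr //; apply: tS;
  by rewrite !inE eqxx ?orbT.
have relB t : t \in L -> rel t *m B = 0.
  move=> tL; have lti : (index t L < size L)%N by rewrite index_mem.
  rewrite -[_ = 0]/(mxkernel B (rel t)) kerB imA'.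
  by exists (delta_mx 0 (Ordinal lti)); rewrite -rowE rowK nth_index.
have : mxkernel B (eps m).
  apply/rowP => l; rewrite [RHS]mxE.
  apply: (Lm (fun x => (eps x *m B) 0 l)) => t /relB/matrixP/(_ 0 l).
  rewrite /rel !mulmxBl mulmxDl -scalemxAl !mxE => /eqP.
  by rewrite subr_eq0 => /eqP.
have mS : m \in S by rewrite mem_undup mem_head.
rewrite kerB imA' => -[u uE]; rewrite -(evK m mS) uE.
rewrite mulmx_sum_row linear_sum big1 // => i _.
by rewrite linearZ rowK /= relS ?scaler0 ?mem_nth ?ltn_ord.
Qed.

(** A system W y = 0 in F holds at all h that respect some finite LL. At
    each of these h, the solution is a combination of the generators of ker
    W, and the coefficients u h of these combinations define elements of F. *)
Lemma reduced_power_flat (F : lmodType R)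
    (p : {linear ((M -> R) -> R^o) -> F}) :
  surjective p -> (forall f, p f = 0 <-> eventually_zero f) ->
  equationally_flat F.
Proof.
move=> surjp p0 q y k W yW.
have /choice[Y YE] (j : 'I_q) : exists f, p f = y (delta_mx 0 j) := surjp _.
have /choice[L LP] i : exists L : seq (R * M * M), forall h, respects L h ->
    \sum_j W i j * Y j h = 0.
  have : eventually_zero (\sum_j W i j *: Y j).
    apply/p0; rewrite linear_sum -[RHS](yW i) linear_rowE.
    by apply: eq_bigr => j _; rewrite linearZ YE mxE.
  move=> [L LP]; exists L => h /LP; rewrite fct_sumE.
  by under eq_bigr do rewrite fctE.
have [_ [_ [C [_ _ _ kerW]]]] := perR W^T.
pose LL := flatten [seq L i | i <- enum 'I_k].
have /choice[u uP] h :
    exists u : 'rV[R]_q, respects LL h -> (\row_j Y j h) = u *m C.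
  have [hL|] := EM (respects LL h); last by exists 0.
  suff [u uE] : mximage C (\row_j Y j h) by exists u.
  rewrite -kerW; apply/rowP => i; rewrite !mxE.
  under eq_bigr do rewrite !mxE mulrC.
  apply: LP; apply: respects_sub hL => t tL; apply/flattenP.
  by exists (L i) => //; apply: map_f; rewrite mem_enum.
have [z zE] := linear_of_family (fun l : 'I_q => p (fun h => u h 0 l)).
exists q, C^T, z; split.
  rewrite -[W]trmxK -trmx_mul; apply/eqP; rewrite trmx_eq0; apply/eqP.
  apply/row_matrixP => i; rewrite row_mul row0.
  rewrite -[_ = 0]/(mxkernel W^T (row i C)) kerW.
  by exists (delta_mx 0 i); rewrite rowE.
move=> v; rewrite linear_rowE zE.
transitivity (p (\sum_j v 0 j *: Y j)).
  by rewrite linear_sum; apply: eq_bigr => j _; rewrite linearZ YE.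
transitivity
  (p (\sum_l (v *m C^T) 0 l *: (fun h => u h 0 l : R^o))); last first.
  by rewrite linear_sum; apply: eq_bigr => j _; rewrite linearZ.
apply/eqP; rewrite -subr_eq0 -linearB; apply/eqP/p0.
exists LL => h /uP uh; rewrite !fctE !fct_sumE.
apply/eqP; rewrite subr_eq0; apply/eqP.
transitivity (((\row_j Y j h) *m v^T) 0 0).
  by rewrite mxE; apply: eq_bigr => j _; rewrite !mxE mulrC.
rewrite uh -mulmxA -[C]trmxK -trmx_mul mxE.
by apply: eq_bigr => l _; rewrite [_^T l 0]mxE mulrC trmxK.
Qed.

(** An element m goes to the evaluation at m, which is linear in m up to
    [eventually_zero] because any given relation may be added to the list. *)
Lemma flat_embedding :
  exists (F : lmodType R) (i : {linear M -> F}), flat F /\ injective i.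
Proof.
have [F [p [surjp p0]]] := ex_quotient eventually_zero_submodule.
have [i iE] : exists i : {linear M -> F},
    i =1 fun m => p (fun h : M -> R => h m : R^o).
  apply: linear_of => a m m'; rewrite -linearP; apply/eqP.
  rewrite -subr_eq0 -linearB; apply/eqP/p0; exists [:: (a, m, m')] => h hL.
  by rewrite !fctE (hL (a, m, m')) ?mem_head // subrr.
exists F, i; split.
  exact/equationally_flat_flat/reduced_power_flat/p0.
move=> m m' imm'; apply/eqP; rewrite -subr_eq0; apply/eqP.
have : i (m - m') = 0 by rewrite linearB imm' subrr.
by rewrite iE => /p0[L]; exact: respecting_separates.
Qed.

End ReducedPower.

(** * Annihilators from flat embeddings *)

(** The injection R/ann d -> R given by multiplication by d sends the tensor
    of 1 and x to that of d and x, which is 0. So the tensor of 1 and x is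
    already 0 over R/ann d, and (R/ann d) tensored with F is F/(ann d) F. *)
Lemma flat_torsion (R : comPzRingType) (F : lmodType R) (d : R) (x : F) :
  flat F -> d *: x = 0 ->
  exists2 s : seq (R * F),
    all (fun p => p.1 * d == 0) s & x = \sum_(p <- s) p.1 *: p.2.
Proof.
move=> flatF dx.
pose N : set F := [set y | exists2 s : seq (R * F),
  all (fun p => p.1 * d == 0) s & y = \sum_(p <- s) p.1 *: p.2].
have subN : is_submodule N.
  split=> [|_ _ [s sd ->] [t td ->]|a _ [s sd ->]].
  - by exists [::]; rewrite ?big_nil.
  - by exists (s ++ t); [rewrite all_cat sd|rewrite big_cat].
  - exists [seq (a * p.1, p.2) | p <- s].
      rewrite all_map; apply: sub_all sd => p /= /eqP pd.
      by rewrite -mulrA pd mulr0.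
    by rewrite big_map scaler_sumr; apply: eq_bigr => p _; rewrite scalerA.
have subA : is_submodule (annihilator d : set R^o).
  split=> [|a b ad bd|a b bd]; rewrite /annihilator /=; first exact: mul0r.
    by rewrite mulrDl ad bd addr0.
  by rewrite -mulrA bd mulr0.
have [A [p [surjp p0]]] := ex_quotient subA.
have [m mE] : exists m : {linear R^o -> R^o}, m =1 fun r => r * d.
  by apply: (@linear_of R R^o R^o) => a r r'; rewrite mulrDl -mulrA.
have [f fE] : exists f : {linear A -> R^o}, forall r, f (p r) = m r.
  by apply: factor_linear => // r /p0; rewrite mE.
have injf : injective f.
  move=> a a'; have [r <-] := surjp a; have [r' <-] := surjp a'.
  rewrite !fE !mE => /eqP; rewrite -subr_eq0 -mulrBl => /eqP rd.
  by apply/eqP; rewrite -subr_eq0 -linearB; apply/eqP/p0.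
have [F' [p' [_ p'0]]] := ex_quotient subN.
have pN (r r' : R) (y : F) : p r = p r' -> p' (r *: y) = p' (r' *: y).
  move=> /eqP; rewrite -subr_eq0 -linearB => /eqP/p0 rd.
  apply/eqP; rewrite -subr_eq0 -linearB -scalerBl; apply/eqP/p'0.
  by exists [:: (r - r', y)]; rewrite ?big_seq1 //= andbT; apply/eqP.
have /choice[l lP] := surjp.
(* This is the map from the tensor product to F/(ann d) F; l lifts R/ann d
   to R. *)
have contract (s t : seq (A * F)) : tensor_eq s t ->
    \sum_(q <- s) p' (l q.1 *: q.2) = \sum_(q <- t) p' (l q.1 *: q.2).
Proof.
elim=> {s t}.
- by [].
- by [].
- by move=> s t u _ -> _ ->.
- by move=> s s' t t' _ e _ e'; rewrite !big_cat e e'.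
- by move=> s t; rewrite !big_cat /= addrC.
- by move=> y; rewrite big_seq1 big_nil /= (pN _ 0) ?scale0r ?lP ?linear0.
- by move=> a; rewrite big_seq1 big_nil /= scaler0 linear0.
- move=> a b y; rewrite big_seq1 big_cons big_seq1 /= (pN _ (l a + l b)).
    by rewrite scalerDl linearD.
  by rewrite linearD !lP.
- by move=> a y z; rewrite big_seq1 big_cons big_seq1 /= scalerDr linearD.
- move=> r a y; rewrite !big_seq1 /= (pN _ (r * l a)) ?scalerA 1?mulrC //.
  by rewrite -[l a * r]mulrC -[r * l a]/(r *: (l a : R^o)) linearZ /= !lP.
have : tensor_map f (\pi_(tensor A F) [:: (p 1, x)]) =
    tensor_map f (\pi_(tensor A F) [::]).
  rewrite !tensor_map_pi /= fE mE mul1r; apply/eqP/eq_tensorP.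
  rewrite -[d in (d, x)]mulr1; apply: tensor_trans (tensor_Z d (1 : R^o) x) _.
  by rewrite dx; exact: tensor_0r.
move=> /(flatF _ _ _ injf)/eqP/eq_tensorP/contract.
rewrite big_seq1 big_nil /= (pN _ 1) ?lP // scale1r.
by move/p'0.
Qed.

Lemma semiregular_finitely_annihilated (R : comPzRingType) :
  semiregular R -> forall d : R, finitely_annihilated d.
Proof.
move=> semR d; have subd : is_submodule (multiples d : set R^o).
  split=> [|_ _ [t ->] [u ->]|a _ [t ->]]; first by exists 0; rewrite mul0r.
    by exists (t + u); rewrite mulrDl.
  by exists (a * t); rewrite -mulrA.
have [Q [p [_ p0]]] := ex_quotient subd.
have [F [i [flatF inji]]] := semR Q.
have rx r : r *: i (p 1) = i (p r).
  by rewrite -!linearZ; congr (i (p _)); exact: mulr1.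
have [|s sd xE] := flat_torsion (d := d) (x := i (p 1)) flatF.
  rewrite rx (_ : p d = 0) ?linear0 //.
  by apply/p0; exists 1; rewrite mul1r.
exists [seq q.1 | q <- s] => r; split=> [[t ->] _ /mapP[q qs ->]|rs].
  by rewrite -mulrA [d * _]mulrC (eqP (allP sd q qs)) mulr0.
apply/p0/inji; rewrite linear0 -rx xE scaler_sumr big1_seq // => q /andP[_ qs].
by rewrite scalerA rs ?scale0r // map_f.
Qed.

(** * Periodic resolutions of cyclic modules *)

Section PeriodicResolution.
Variable R : comPzRingType.

(** The exact sequence 0 -> R/(a, b) -> Q -> (a, b) -> 0 with Q projective,
    where Q is the kernel of [cover_rel] and the second map is [cover_val].
    The first two generators of Q lift a and b, and the third is the image
    of 1; they have [cover_coord] for a dual basis. *)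
Record periodic_cover (a b : R) : Type := PeriodicCover {
  cover : lmodType R;
  cover_base : lmodType R;
  cover_rel : {linear cover -> cover_base};
  cover_val : {linear cover -> R^o};
  cover_gen : 'I_3 -> cover;
  cover_coord : {linear cover -> 'rV[R]_3};
  cover_relE : forall j, cover_rel (cover_gen j) = 0;
  cover_val0 : cover_val (cover_gen 0) = a;
  cover_val1 : cover_val (cover_gen 1) = b;
  cover_val2 : cover_val (cover_gen 2) = 0;
  cover_syzygy : forall q, cover_rel q = 0 -> cover_val q = 0 ->
    exists t, q = t *: cover_gen 2;
  cover_coordK : forall q, cover_rel q = 0 ->
    q = \sum_j cover_coord q 0 j *: cover_gen j;
  cover_ann : forall r, r *: cover_gen 2 = 0 <-> exists x y, r = x * a + y * b
}.

Lemma linear_pair (U V W : lmodType R) (f : {linear U -> W})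
    (g : {linear V -> W}) :
  exists h : {linear (U * V)%type -> W}, forall u, h u = f u.1 + g u.2.
Proof.
apply: (@linear_of R (U * V)%type W) => t u v /=.
by rewrite !linearP scalerDr addrACA.
Qed.

Lemma sum3E (V : nmodType) (g : 'I_3 -> V) : \sum_j g j = g 0 + (g 1 + g 2).
Proof.
rewrite !big_ord_recl big_ord0 addr0.
by congr (_ + (g _ + g _)); apply/val_inj.
Qed.

Lemma linear_scalar (V : lmodType R) (x : V) :
  exists f : {linear R^o -> V}, forall r, f r = r *: x.
Proof.
by apply: (@linear_of R R^o V) => t r s; rewrite scalerDl scalerA.
Qed.

(** Let P2 -> P1 -> R/(a, b) be given by the resolution, and lift the
    generator of R/(a, b) to p1 in P1. The map D : P2 + R -> P1 that extends
    d by p1 is onto, with the pullback Q for kernel. It splits by s because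
    P1 is projective, so three generators of Q and the section s together
    map onto P2 + R; lifting P2 + R along this map gives the dual basis. *)
Lemma ex_periodic_cover (a b : R) :
  (forall M : lmodType R,
     finitely_presented M -> cyclic_module M -> two_periodic M) ->
  inhabited (periodic_cover a b).
Proof.
move=> per.
pose I : set R^o := [set r | exists x y, r = x * a + y * b].
have subI : is_submodule I.
  split=> [|_ _ [x [y ->]] [x' [y' ->]]|t _ [x [y ->]]].
  - by exists 0, 0; rewrite !mul0r addr0.
  - by exists (x + x'), (y + y'); rewrite !mulrDl addrACA.
  - by exists (t * x), (t * y); rewrite -!mulrA -mulrDr.
have [M [p [surjp p0]]] := ex_quotient subI.
have pE (r : R) : p r = r *: p 1.
  by rewrite -linearZ; congr (p _); exact: esym (mulr1 _).
have [P2 [P1 [i [d [e [[projP1 projP2] inji exi exd surje]]]]]] :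
    two_periodic M.
  apply: per; last first.
    by exists (p 1) => m; have [r <-] := surjp m; exists r; rewrite pE.
  have [f fE] : exists f : {linear 'rV[R]_1 -> M}, forall v, f v = p (v 0 0).
    by apply: (@linear_of R _ M) => t u v; rewrite !mxE -linearP.
  pose A : 'M[R]_(2, 1) := \matrix_(k, j) (if k == 0 then a else b).
  have AE v : (v *m A) 0 0 = v 0 0 * a + v 0 1 * b.
    rewrite mxE big_ord_recl big_ord1 !mxE /=.
    by congr (_ + v 0 _ * b); apply/val_inj.
  exists 2%N, 1%N, (mulmxr A), f; split; last first.
    by move=> m; have [r <-] := surjp m; exists r%:M; rewrite fE mxE mulr1n.
  move=> v; rewrite fE p0; split=> [[x [y vE]]|[u <-]].
    exists (\row_j if j == 0 then x else y); apply/rowP => j.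
    by rewrite ord1 [LHS]AE !mxE vE.
  by exists (u 0 0), (u 0 1); rewrite /= AE.
have [p1 ep1] := surje (p 1).
pose W := (P2 * R^o)%type.
have [l1 l1E] := linear_scalar p1.
have [D DE0] := linear_pair d l1.
have DE z (r : R) : D (z, r) = d z + r *: p1 by rewrite DE0 l1E.
have ep (r : R) : e (r *: p1) = p r by rewrite pE linearZ ep1.
have surjD : surjective D.
  move=> y; have [r pr] := surjp (e y).
  have /exd[z dz] : e (y - r *: p1) = 0 by rewrite linearB ep pr subrr.
  by exists (z, r); rewrite DE dz subrK.
have [s sK] : exists s : {linear P1 -> W}, forall y, D (s y) = y.
  exact: (projP1 _ _ D idfun surjD).
have lift (r : R) : I r -> exists z, D (z, r) = 0.
  move=> /p0 pr; have /exd[z dz] : e (- (r *: p1)) = 0.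
    by rewrite linearN ep pr oppr0.
  by exists z; rewrite DE dz addNr.
have [z0 w0E] : exists z, D (z, a) = 0.
  by apply: lift; exists 1, 0; rewrite mul1r mul0r addr0.
have [z1 w1E] : exists z, D (z, b) = 0.
  by apply: lift; exists 0, 1; rewrite mul1r mul0r add0r.
pose g (j : 'I_3) : W :=
  nth 0 [:: (z0, a : R^o); (z1, b : R^o); (i (p 1), 0)] j.
have syz q : D q = 0 -> q.2 = 0 -> exists t, q = t *: g 2.
  case: q => z r /= + r0; rewrite r0 DE scale0r addr0 => /exi[m <-].
  have [t <-] := surjp m; exists t; rewrite pE linearZ.
  by apply/pair_equal_spec; split=> //=; rewrite scaler0.
have Dg j : D (g j) = 0.
  case: j => -[|[|[|//]]] /= lt; rewrite /g //=.
  by rewrite DE scale0r addr0; apply/exi; exists (p 1).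
have DZ x j : D (x *: g j) = 0 by rewrite linearZ Dg; exact: scaler0.
have [G GE] := linear_of_family g.
have [T TE] := linear_pair G s.
have surjT : surjective T.
  move=> w; pose q := w - s (D w).
  have Dq : D q = 0 by rewrite linearB sK subrr.
  have [x [y qE]] : I q.2.
    apply/p0; move: Dq; case: (q) => z r; rewrite DE /= => dz.
    rewrite -ep; apply/exd; exists (- z); rewrite linearN; apply/eqP.
    by rewrite eqr_oppLR -addr_eq0 dz.
  have [||t tE] := syz (q - x *: g 0 - y *: g 1).
  - by rewrite 2!linearB Dq !DZ !subr0.
  - by rewrite -[LHS]/(q.2 - x * a - y * b) qE; ring.
  exists (\row_j nth 0 [:: x; y; t] j, D w); rewrite TE GE sum3E !mxE /= -tE.
  by rewrite [y *: _ + _]addrC subrK [x *: _ + _]addrC subrK /q subrK.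
have [inc incE] : exists f : {linear P2 -> W}, forall z, f z = (z, 0).
  apply: (@linear_of R P2 W) => r u v; apply/pair_equal_spec; split=> //=.
  by rewrite addr0 scaler0.
have [h hK] := projP2 _ _ T inc surjT.
have [u0 u0E] := surjT (0, 1).
have [l0 l0E] := linear_scalar u0.
have [C0 C0E] := linear_pair h l0.
have C0K w : T (C0 w) = w.
  case: w => z r; rewrite C0E linearD hK incE l0E linearZ u0E /=.
  apply/pair_equal_spec; split=> /=; rewrite ?scaler0 ?addr0 ?add0r //.
  exact: mulr1.
have C0D w : D w = 0 -> (C0 w).2 = 0.
  by rewrite -{1}[w]C0K TE linearD sK GE linear_sum big1 ?add0r.
have [C CE] : exists C : {linear W -> 'rV[R]_3}, forall w, C w = (C0 w).1.
  by apply: (@linear_of R W _) => r u v; rewrite linearP.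
have [V VE] : exists V : {linear W -> R^o}, forall w, V w = w.2.
  by apply: (@linear_of R W _).
have V0 : V (g 0) = a by rewrite VE.
have V1 : V (g 1) = b by rewrite VE.
have V2 : V (g 2) = 0 by rewrite VE.
have Vsyz q : D q = 0 -> V q = 0 -> exists t, q = t *: g 2.
  by rewrite VE; exact: syz.
have CK q : D q = 0 -> q = \sum_j C q 0 j *: g j.
  by move=> Dq; rewrite -{1}[q]C0K TE C0D // linear0 addr0 GE CE.
have annE (r : R) : r *: g 2 = 0 <-> exists x y, r = x * a + y * b.
  rewrite -[exists x, _]/(I r) -p0 pE; split=> [|rp].
    by move=> /(congr1 fst) rp; apply: inji; rewrite linear0 linearZ.
  apply/pair_equal_spec; split=> /=; last exact: scaler0.
  by rewrite -linearZ rp linear0.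
exact: inhabits (PeriodicCover Dg V0 V1 V2 Vsyz CK annE).
Qed.

(** The local computation at P, in terms of the matrix M = (m_ij) of
    coordinates of the two generators g_0 and g_1 of Q that lift a and b,
    with v the common denominator. If M is not congruent to v mod P, then
    one of the generators is locally a multiple of the other. Otherwise det
    M is a unit at P and M = v locally, because M (M - v) = 0: the two
    generators form a basis. The vector g_2, with coordinates k1 and k2,
    then spans all syzygies, among them k1 g_0 = s g_2. If s is a unit at P
    this forces k2 = 0, otherwise v - s is a unit and k1 = 0. In the Koszul
    relation a g_1 - b g_0 = t g_2 one of the coefficients a and b therefore
    vanishes locally. *)
Lemma local_matrix_comparison (P : set R)
    (a b v m11 m12 m21 m22 k1 k2 s t : R) :
  maximal_ideal P -> ~ P v ->
  v * a = m11 * a + m21 * b -> v * b = m12 * a + m22 * b ->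
  v * m11 = m11 * m11 + m21 * m12 -> v * m21 = m11 * m21 + m21 * m22 ->
  v * m12 = m12 * m11 + m22 * m12 -> v * m22 = m12 * m21 + m22 * m22 ->
  a * m12 - b * m11 = t * k1 -> a * m22 - b * m21 = t * k2 ->
  k1 * m11 = s * k1 -> k1 * m21 = s * k2 ->
  ldiv P a b \/ ldiv P b a.
Proof.
move=> maxP Pv va vb e11 e21 e12 e22 kz1 kz2 s1 s2.
have idP := maximal_is_ideal maxP.
have [P1|] := EM (P (v - m11)); last first.
  right; exists (v - m11) => //; exists m21.
  by rewrite mulrBl va addrAC subrr add0r.
have [P2|] := EM (P m21); last first.
  left; exists m21 => //; exists (v - m11).
  by rewrite mulrBl va addrAC subrr add0r.
have [P3|] := EM (P (v - m22)); last first.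
  by left; exists (v - m22) => //; exists m12; rewrite mulrBl vb addrK.
have [P4|] := EM (P m12); last first.
  by right; exists m12 => //; exists (v - m22); rewrite mulrBl vb addrK.
pose D := m11 * m22 - m12 * m21.
have PD : ~ P D.
  move=> PD; apply: (maximalM maxP Pv Pv).
  have -> : v * v = D + (v * (v - m11) + (m11 * (v - m22) + m12 * m21)).
    by rewrite /D; ring.
  by do 3?apply: idealD => //; exact: idealMl.
have D11 : D * m11 = D * v.
  apply/eqP; rewrite -subr_eq0; apply/eqP.
  have -> : D * m11 - D * v = m22 * (m11 * m11 + m21 * m12 - v * m11)
     - m12 * (m11 * m21 + m21 * m22 - v * m21) by rewrite /D; ring.
  by rewrite -e11 -e21 !subrr !mulr0 subrr.
have D22 : D * m22 = D * v.
  apply/eqP; rewrite -subr_eq0; apply/eqP.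
  have -> : D * m22 - D * v = m11 * (m12 * m21 + m22 * m22 - v * m22)
     - m21 * (m12 * m11 + m22 * m12 - v * m12) by rewrite /D; ring.
  by rewrite -e22 -e12 !subrr !mulr0 subrr.
have D21 : D * m21 = 0.
  have -> : D * m21 = m11 * (m11 * m21 + m21 * m22 - v * m21)
     - m21 * (m11 * m11 + m21 * m12 - v * m11) by rewrite /D; ring.
  by rewrite -e11 -e21 !subrr !mulr0 subrr.
have D12 : D * m12 = 0.
  have -> : D * m12 = m22 * (m12 * m11 + m22 * m12 - v * m12)
     - m12 * (m12 * m21 + m22 * m22 - v * m22) by rewrite /D; ring.
  by rewrite -e12 -e22 !subrr !mulr0 subrr.
have [Ps|Ps] := EM (P s).
  left; exists (D * v * (v - s)); last first.
    exists 0; rewrite mul0r.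
    have -> : D * v * (v - s) * b = (v - s) * (b * (D * v)) by ring.
    rewrite -D11.
    have -> : (v - s) * (b * (D * m11)) =
      (v - s) * (a * (D * m12)) - D * (v - s) * (a * m12 - b * m11) by ring.
    rewrite D12 kz1.
    have -> : D * (v - s) * (t * k1) = t * (k1 * (D * v) - D * (s * k1)).
      by ring.
    by rewrite -D11 -s1; ring.
  apply: maximalM => //; first exact: maximalM.
  by move=> Pvs; apply: Pv; rewrite -[v](subrK s); exact: idealD.
right; exists (D * v * s); first by apply: maximalM => //; exact: maximalM.
exists 0; rewrite mul0r.
have -> : D * v * s * a = s * (a * (D * v)) by ring.
rewrite -D22.
have -> : s * (a * (D * m22)) =
    s * (D * (a * m22 - b * m21)) + s * b * (D * m21) by ring.
rewrite D21 kz2.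
have -> : s * (D * (t * k2)) = t * (D * (s * k2)) by ring.
have -> : D * (s * k2) = k1 * (D * m21) by rewrite -s2; ring.
by rewrite D21; ring.
Qed.

Section FromPeriodicCyclic.
Hypothesis perR :
  forall M : lmodType R,
    finitely_presented M -> cyclic_module M -> two_periodic M.

(** The generator of R/d in the projective module Q and its three
    coordinates have the same annihilator. *)
Lemma periodic_finitely_annihilated (d : R) : finitely_annihilated d.
Proof.
have [Q] := ex_periodic_cover d 0 perR.
pose c := cover_coord Q (cover_gen Q 2).
have c0 (r : R) : r *: cover_gen Q 2 = 0 <-> multiples d r.
  rewrite cover_ann; split=> [[x [y ->]]|[x ->]].
    by exists x; rewrite mulr0 addr0.
  by exists x, 0; rewrite mulr0 addr0.
exists [seq c 0 j | j <- enum 'I_3] => r; rewrite -c0; split.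
  move=> rc _ /mapP[j _ ->]; have := congr1 (fun w => cover_coord Q w 0 j) rc.
  by rewrite /= linearZ linear0 !mxE.
move=> rc; rewrite [cover_gen Q 2](cover_coordK (cover_relE Q 2)) scaler_sumr.
by rewrite big1 // => j _; rewrite scalerA rc ?scale0r // map_f ?mem_enum.
Qed.

(** The coordinates of g_2 are killed by a and b. If the last of them,
    f_2(g_2), is a unit at P, then (a, b) vanishes locally. Otherwise v = 1
    - f_2(g_2) is a unit, g_2 can be eliminated from the generators of Q at
    the cost of this denominator, and psi is the dual basis for g_0 and g_1
    that results. *)
Lemma periodic_locally_comparable : locally_comparable R.
Proof.
move=> P a b maxP; have [Q] := ex_periodic_cover a b perR.
pose g := cover_gen Q; pose D := cover_rel Q; pose V := cover_val Q.
pose f j q : R := cover_coord Q q 0 j.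
have fP j (x : R) q q' : f j (x *: q + q') = x * f j q + f j q'.
  by rewrite /f linearP !mxE.
have fZ j (x : R) q : f j (x *: q) = x * f j q by rewrite /f linearZ !mxE.
have fB j q q' : f j (q - q') = f j q - f j q' by rewrite /f linearB !mxE.
have DZ (x : R) j : D (x *: g j) = 0.
  by rewrite linearZ [D _](cover_relE Q); exact: scaler0.
have ac : a *: g 2 = 0.
  by apply/cover_ann; exists 1, 0; rewrite mul1r mul0r addr0.
have bc : b *: g 2 = 0.
  by apply/cover_ann; exists 0, 1; rewrite mul1r mul0r add0r.
have afc j : a * f j (g 2) = 0 by rewrite -fZ ac /f linear0 mxE.
have bfc j : b * f j (g 2) = 0 by rewrite -fZ bc /f linear0 mxE.
pose v := 1 - f 2 (g 2); have [Pv|Pv] := EM (P v).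
  left; exists (f 2 (g 2)); last by exists 0; rewrite mulrC bfc mul0r.
  move=> Pc; apply: (maximal1 maxP); rewrite -(subrK (f 2 (g 2)) 1).
  exact: (idealD (maximal_is_ideal maxP)).
have fK q : D q = 0 -> q = f 0 q *: g 0 + (f 1 q *: g 1 + f 2 q *: g 2).
  by move=> Dq; rewrite -(sum3E (fun j => f j q *: g j)); exact: cover_coordK.
have vg2 : v *: g 2 = f 0 (g 2) *: g 0 + f 1 (g 2) *: g 1.
  by rewrite scalerBl scale1r {1}(fK (g 2)) ?addrA ?addrK //; exact: cover_relE.
pose psi k q := v * f k q + f 2 q * f k (g 2).
have vE q : D q = 0 -> v *: q = psi 0 q *: g 0 + psi 1 q *: g 1.
  move=> Dq; rewrite {1}(fK q Dq) !scalerDr !scalerA [v * f 2 q]mulrC.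
  rewrite -[(f 2 q * v) *: _]scalerA vg2 scalerDr !scalerA addrA addrACA.
  by rewrite -!scalerDl.
have psiP k (x y : R) q q' :
    psi k (x *: q + y *: q') = x * psi k q + y * psi k q'.
  by rewrite /psi !fP !fZ; ring.
have psiZ k (x : R) q : psi k (x *: q) = x * psi k q by rewrite /psi !fZ; ring.
have Dg j : D (g j) = 0 by exact: cover_relE.
have VP (x y : R) q q' : V (x *: q + y *: q') = x * V q + y * V q'.
  by rewrite linearP linearZ.
have Va : V (g 0) = a by exact: cover_val0.
have Vb : V (g 1) = b by exact: cover_val1.
(* The Koszul syzygy a g_1 - b g_0 has value a b - b a = 0. *)
have [t tE] : exists t : R, a *: g 1 + (- b) *: g 0 = t *: g 2.
  apply: cover_syzygy; first by rewrite linearD -!/(D _) !DZ addr0.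
  by rewrite -/(V _) VP Va Vb; ring.
(* psi_0(g_2) g_0 is a syzygy because a kills the coordinates of g_2. *)
have [s sE] : exists s : R, psi 0 (g 2) *: g 0 = s *: g 2.
  apply: cover_syzygy; first exact: DZ.
  rewrite linearZ -/(V _) Va -[LHS]/(psi 0 (g 2) * a) /psi.
  have -> : (v * f 0 (g 2) + f 2 (g 2) * f 0 (g 2)) * a =
     (v + f 2 (g 2)) * (a * f 0 (g 2)) by ring.
  by rewrite afc mulr0.
have psiM k j :
    v * psi k (g j) = psi 0 (g j) * psi k (g 0) + psi 1 (g j) * psi k (g 1).
  by rewrite -psiZ vE ?psiP.
have VM j : v * V (g j) = psi 0 (g j) * a + psi 1 (g j) * b.
  by have := congr1 V (vE _ (Dg j)); rewrite VP Va Vb linearZ.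
have psit k : a * psi k (g 1) - b * psi k (g 0) = t * psi k (g 2).
  by rewrite -[RHS]psiZ -tE psiP mulNr.
apply: (local_matrix_comparison maxP Pv _ _ (psiM 0 0) (psiM 1 0) (psiM 0 1)
  (psiM 1 1) (psit 0) (psit 1) (s := s)).
- by rewrite -VM Va.
- by rewrite -VM Vb.
- by rewrite -!psiZ sE.
- by rewrite -!psiZ sE.
Qed.

End FromPeriodicCyclic.
End PeriodicResolution.

(** * Arithmetical rings *)

Section Arithmetical.
Variables (R : comPzRingType) (P : set R) (maxP : maximal_ideal P).

Local Notation loc := (localization (max_compl maxP)).
Local Notation den := {s : R | s \in max_compl maxP}.

Lemma ldiv_localization (a b : R) (s t : den) : ldiv P a b ->
  exists z : localization_at maxP, \pi_loc (b, t) = z * \pi_loc (a, s).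
Proof.
move=> [u Pu [r ub]]; have uS : u \in max_compl maxP by apply/max_complP.
pose v : den := Localization.denM (exist _ u uS) t.
exists (\pi_loc (r * val s, v)).
rewrite -[RHS]/(Localization.mul _ _) !piE; apply/eqP/Localization.eq_piP.
exists (Localization.den1 _); rewrite /= !mul1r.
have -> : b * (u * sval t * sval s) = (u * b) * (sval t * sval s) by ring.
by rewrite ub; ring.
Qed.

Lemma localization_ldiv (a b : R) (y : localization_at maxP) :
  \pi_loc (b, Localization.den1 _) = y * \pi_loc (a, Localization.den1 _) ->
  ldiv P a b.
Proof.
elim/quotW: y => -[c s]; rewrite -[_ * _]/(Localization.mul _ _) !piE.
move=> /eqP/Localization.eq_piP[u] /= e; exists (val u * val s).
  by apply: maximalM => //; apply/(max_complP maxP); exact: valP.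
exists (val u * c); move: e; rewrite !mulr1 => e.
by rewrite mulrAC -mulrA e mulrA.
Qed.

End Arithmetical.

(** Comparing principal ideals suffices: two incomparable ideals would
    contain incomparable elements. *)
Lemma arithmetical_locally_comparable (R : comPzRingType) :
  arithmetical R <-> locally_comparable R.
Proof.
split=> [ariR P a b maxP|cmpR P maxP I J [_ _ IM] [_ _ JM]].
  pose e (x : R) : localization_at maxP :=
    \pi_(localization (max_compl maxP)) (x, Localization.den1 _).
  have idM x : is_ideal [set z | exists y, z = y * e x].
    split=> [|_ _ [y ->] [z ->]|c _ [y ->]]; first by exists 0; rewrite mul0r.
      by exists (y + z); rewrite mulrDl.
    by exists (c * y); rewrite mulrA.
  have eM x : exists y, e x = y * e x by exists 1; rewrite mul1r.
  have [ab|ba] := ariR P maxP _ _ (idM a) (idM b).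
    by right; have [y] := ab _ (eM a); exact: localization_ldiv.
  by left; have [y] := ba _ (eM b); exact: localization_ldiv.
have [|/existsNP[x /not_implyP[Ix Jx]]] := pselect (I `<=` J); first by left.
right=> y; elim/quotW: y => -[b t] Jb; elim/quotW: x Ix Jx => -[a s] Ia Ja.
have [ab|ba] := cmpR P a b maxP.
  by have [z ->] := ldiv_localization s t ab; exact: IM.
by have [z e] := ldiv_localization t s ba; case: Ja; rewrite e; exact: JM.
Qed.

(** * The equivalence *)

Theorem corollary4p3 (R : comPzRingType) :
  semilocal R ->
  [<-> two_semiregular R;
       forall M : lmodType R,
         finitely_presented M -> cyclic_module M -> two_periodic M;
       semiregular R /\ arithmetical R].
Proof.
move=> semiR; tfae.
- by move=> perR M fpM _; exact: perR.
- move=> perR; have cmpR := periodic_locally_comparable perR.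
  split; last exact/arithmetical_locally_comparable.
  move=> M; apply: flat_embedding; apply: all_periodic_mx => //.
  by apply: ex_periodic_elements => //; exact: periodic_finitely_annihilated.
- move=> [semR /arithmetical_locally_comparable cmpR].
  apply: periodic_mx_two_semiregular; apply: all_periodic_mx => //.
  by apply: ex_periodic_elements => //; exact: semiregular_finitely_annihilated.
Qed.
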